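(* Let $R$ be a commutative ring (unital and non-zero) and let $Q$ be a finite quiver. If $X$ and $Y$ are rigid $RQ$-lattices, then $\operatorname{Hom}_{RQ}(X,Y)$ and $\operatorname{Ext}^1_{RQ}(X,Y)$ are finitely generated projective $R$-modules.
   Context: $Q=(Q_0,Q_1,h,t)$ is a finite quiver (oriented cycles allowed), where an arrow $a\in Q_1$ goes from vertex $t(a)$ to vertex $h(a)$; $RQ$ is its path algebra over $R$, with trivial paths $e_i$ for $i\in Q_0$. An $RQ$-lattice is a left $RQ$-module $X$ which is finitely generated projective as an $R$-module; equivalently, a representation of $Q$ given by a finitely generated projective $R$-module $X_i=e_iX$ for each vertex $i$ and an $R$-module homomorphism $X_{t(a)}\to X_{h(a)}$ for each arrow $a$. An $RQ$-module $X$ is rigid if $\operatorname{Ext}^1_{RQ}(X,X)=0$. *)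

(* Defs.v *)
From HB Require Import structures.
From mathcomp Require Import all_boot all_algebra.
From mathcomp Require Import boolp classical_sets functions cardinality fsbigop.

Set Implicit Arguments.
Unset Strict Implicit.
Unset Printing Implicit Defensive.

Import GRing.Theory.
Local Open Scope ring_scope.

Section FinitelyGeneratedProjective.
Variables (R : pzRingType) (M : lmodType R).

Definition finitely_generated : Prop :=
  exists s : seq M, forall x : M,
    exists c : 'I_(size s) -> R, x = \sum_(i < size s) c i *: s`_i.

Definition projective : Prop :=
  forall (U V : lmodType R) (g : {linear U -> V}) (f : {linear M -> V}),
    (forall v : V, exists u : U, g u = v) ->
    exists h : {linear M -> U}, forall x : M, g (h x) = f x.

Definition fg_projective : Prop := finitely_generated /\ projective.
End FinitelyGeneratedProjective.

Section Kernel.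
Variables (R : pzRingType) (M N : lmodType R) (f : {linear M -> N}).

Definition kernel_pred : {pred M} := fun x => f x == 0.

Lemma kernel_closed : subsemimod_closed kernel_pred.
Proof.
split; [split=> [|x y]|move=> a x]; rewrite !unfold_in /kernel_pred.
- by rewrite linear0.
- by move=> /eqP fx /eqP fy; rewrite linearD fx fy addr0.
- by move=> /eqP fx; rewrite linearZ /= fx scaler0.
Qed.

Record kernel := Kernel { kernel_val :> M; _ : kernel_val \in kernel_pred }.
HB.instance Definition _ := [isSub for kernel_val].
HB.instance Definition _ := [Choice of kernel by <:].
HB.instance Definition _ :=
  GRing.SubChoice_isSubLmodule.Build R M kernel_pred kernel kernel_closed.
End Kernel.

Section QuotientModule.
Variables (R : pzRingType) (M : lmodType R) (S : {pred M}).
Hypothesis S_closed : subsemimod_closed S.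

Definition submod_pred of subsemimod_closed S : {pred M} := S.
Local Notation I := (submod_pred S_closed).
HB.instance Definition _ := GRing.isSubmodClosed.Build R M I S_closed.

Definition quotient_module : Type := Quotient.quot I.
HB.instance Definition _ := GRing.Zmodule.on quotient_module.

Definition quotient_proj (x : M) : quotient_module := \pi_(Quotient.quot I)%qT x.

Lemma quotient_projP (x y : M) :
  quotient_proj x = quotient_proj y <-> x - y \in S.
Proof.
have := Quotient.idealrBE I x y; rewrite /quotient_proj => e.
have -> : (x - y \in S) = (x - y \in I) by [].
by rewrite e; split=> /eqP.
Qed.

Lemma quotient_proj_surj (u : quotient_module) : exists x, quotient_proj x = u.
Proof. by exists (repr (u : Quotient.quot I)); exact: reprK. Qed.

Lemma quotient_projD : {morph quotient_proj : x y / x + y}.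
Proof. by move=> x y; exact: Quotient.pi_add. Qed.

Definition quotient_scale (a : R) (u : quotient_module) : quotient_module :=
  quotient_proj (a *: repr (u : Quotient.quot I)).

Lemma quotient_projZ (a : R) (x : M) :
  quotient_proj (a *: x) = quotient_scale a (quotient_proj x).
Proof.
apply/quotient_projP; rewrite -scalerBr; apply: S_closed.2.
apply/quotient_projP; exact/esym/reprK.
Qed.

Lemma quotient_scaleA a b u :
  quotient_scale a (quotient_scale b u) = quotient_scale (a * b) u.
Proof.
by have [x <-] := quotient_proj_surj u; rewrite -!quotient_projZ scalerA.
Qed.

Lemma quotient_scale1 : left_id 1 quotient_scale.
Proof.
by move=> u; have [x <-] := quotient_proj_surj u; rewrite -quotient_projZ scale1r.
Qed.

Lemma quotient_scaleDr : right_distributive quotient_scale +%R.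
Proof.
move=> a u v; have [x <-] := quotient_proj_surj u.
have [y <-] := quotient_proj_surj v.
by rewrite -quotient_projD -!quotient_projZ scalerDr quotient_projD.
Qed.

Lemma quotient_scaleDl u : {morph quotient_scale^~ u : a b / a + b}.
Proof.
move=> a b; have [x <-] := quotient_proj_surj u.
by rewrite -!quotient_projZ scalerDl quotient_projD.
Qed.

HB.instance Definition _ := GRing.Zmodule_isLmodule.Build R quotient_module
  quotient_scaleA quotient_scale1 quotient_scaleDr quotient_scaleDl.
End QuotientModule.

(* The homology ker g / im f of L --f--> M --g--> N at M.  It is formed as the
   quotient of ker g by the elements lying in im f, so it does not need a proof
   of g \o f = 0. *)
Section Homology.
Variables (R : pzRingType) (L M N : lmodType R).
Variables (f : {linear L -> M}) (g : {linear M -> N}).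

Definition boundary_pred : {pred kernel g} :=
  fun z => `[< exists x : L, f x = val z >].

Lemma boundary_closed : subsemimod_closed boundary_pred.
Proof.
split; [split=> [|u v]|move=> a u]; rewrite !unfold_in /boundary_pred.
- by apply/asboolP; exists 0; rewrite !linear0.
- move=> /asboolP[x fx] /asboolP[y fy]; apply/asboolP; exists (x + y).
  by rewrite !linearD /= fx fy.
- move=> /asboolP[x fx]; apply/asboolP; exists (a *: x).
  by rewrite !linearZ /= fx.
Qed.

Definition homology : lmodType R := quotient_module boundary_closed.
End Homology.

Section FreeModule.
Variables (A : pzRingType) (T : choiceType).

Definition finsupp_pred : {pred T -> A^o} :=
  fun f => `[< finite_set [set t | f t != 0] >].

Lemma finsupp_closed : subsemimod_closed finsupp_pred.
Proof.
split; [split=> [|f g]|move=> a f]; rewrite !unfold_in /finsupp_pred.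
- apply/asboolP; rewrite [X in finite_set X](_ : _ = set0) ?finite_set0 //.
  by rewrite -subset0 => t /=; rewrite eqxx.
- move=> /asboolP ff /asboolP fg; apply/asboolP.
  have h : finite_set ([set t | f t != 0] `|` [set t | g t != 0])%classic.
    by rewrite finite_setU.
  apply: sub_finite_set h => t /= fgt.
  have [f0|fn0] := eqVneq (f t) 0; [right|by left].
  by apply: contra_neq fgt => g0; rewrite /GRing.add /= f0 g0 addr0.
- move=> /asboolP ff; apply/asboolP; apply: sub_finite_set ff => t /=.
  by apply: contra_neq => f0; rewrite /GRing.scale /= f0 scaler0.
Qed.

Record free_module := FreeModule
  { coef_fun : T -> A^o; _ : coef_fun \in finsupp_pred }.
HB.instance Definition _ := [isSub for coef_fun].
HB.instance Definition _ := [Choice of free_module by <:].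
HB.instance Definition _ := GRing.SubChoice_isSubLmodule.Build
  A (T -> A^o)%type finsupp_pred free_module finsupp_closed.

Definition coef (f : free_module) : T -> A := coef_fun f.
Coercion coef : free_module >-> Funclass.

Lemma coef_finite (f : free_module) : finite_set [set t | f t != 0].
Proof. exact/asboolP/(valP f). Qed.

Lemma coefD (f g : free_module) t : (f + g) t = f t + g t.
Proof. by []. Qed.

Lemma coefZ a (f : free_module) t : (a *: f) t = a * f t.
Proof. by []. Qed.

Variables (M : lmodType A) (h : T -> M).

Definition free_lift (f : free_module) : M := \sum_(t \in setT) f t *: h t.

Lemma free_liftE (f : free_module) (s : seq T) : uniq s ->
  (forall t, f t != 0 -> t \in s) -> free_lift f = \sum_(t <- s) f t *: h t.
Proof.
move=> us fs; rewrite /free_lift (fsbigE s) //.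
  by apply: eq_bigl => t; rewrite in_setT.
move=> t _ ts; suff -> : f t = 0 by rewrite scale0r.
by apply/eqP; apply: contraNT ts => /fs.
Qed.

Lemma free_lift_is_linear : linear free_lift.
Proof.
move=> a f g.
have /finite_seqP[s1 e1] := coef_finite f.
have /finite_seqP[s2 e2] := coef_finite g.
pose s := undup (s1 ++ s2).
have us : uniq s by rewrite undup_uniq.
have sf t : f t != 0 -> t \in s.
  move=> ft; have : [set t | f t != 0]%classic t by [].
  by rewrite e1 /= mem_undup mem_cat => ->.
have sg t : g t != 0 -> t \in s.
  move=> ft; have : [set t | g t != 0]%classic t by [].
  by rewrite e2 /= mem_undup mem_cat => ->; rewrite orbT.
rewrite (free_liftE us sf) (free_liftE us sg) (free_liftE us) => [|t].
  rewrite scaler_sumr -big_split /=; apply: eq_bigr => t _.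
  by rewrite scalerA -scalerDl.
rewrite -[(a *: f + g) t]/(a * f t + g t) => nz; have [f0|] := eqVneq (f t) 0; last exact: sf.
by apply: sg; apply: contra_neq nz => ->; rewrite f0 mulr0 addr0.
Qed.

HB.instance Definition _ :=
  GRing.isLinear.Build A free_module M *:%R free_lift free_lift_is_linear.
End FreeModule.

(* [algType R] cannot be used: it requires 0 != 1, which fails for the path
   algebra of the quiver without vertices. *)
Record algebra (R : pzRingType) := MkAlgebra {
  algebra_ring :> pzRingType;
  scalar_map : {rmorphism R -> algebra_ring};
  scalar_map_central : forall r a, scalar_map r * a = a * scalar_map r
}.

Section RestrictionOfScalars.
Variables (R : pzRingType) (A : algebra R) (X : lmodType A).

Definition restrict : Type := X.
HB.instance Definition _ := GRing.Zmodule.on restrict.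

Definition restrict_scale (r : R) (x : restrict) : restrict :=
  scalar_map A r *: (x : X).

Lemma restrict_scaleA r s x :
  restrict_scale r (restrict_scale s x) = restrict_scale (r * s) x.
Proof.
by rewrite /restrict_scale scalerA rmorphM.
Qed.

Lemma restrict_scale1 : left_id 1 restrict_scale.
Proof. by move=> x; rewrite /restrict_scale rmorph1 scale1r. Qed.

Lemma restrict_scaleDr : right_distributive restrict_scale +%R.
Proof. by move=> r x y; exact: scalerDr. Qed.

Lemma restrict_scaleDl x : {morph restrict_scale^~ x : r s / r + s}.
Proof. by move=> r s; rewrite /restrict_scale rmorphD; exact: scalerDl. Qed.

HB.instance Definition _ := GRing.Zmodule_isLmodule.Build R restrict
  restrict_scaleA restrict_scale1 restrict_scaleDr restrict_scaleDl.
End RestrictionOfScalars.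

(* Hom_A(X, Y) with the R-module structure (r f)(x) = r (f x). *)
Section Hom.
Variables (R : pzRingType) (A : algebra R) (X Y : lmodType A).

Definition hom_pred : {pred X -> restrict Y} :=
  fun f => `[< linear (f : X -> Y) >].

Lemma hom_closed : subsemimod_closed hom_pred.
Proof.
split; [split=> [|f g]|move=> r f]; rewrite !unfold_in /hom_pred.
- by apply/asboolP => a x y; rewrite [RHS]addr0 scaler0.
- move=> /asboolP lf /asboolP lg; apply/asboolP => a x y.
  change (f (a *: x + y) + g (a *: x + y) =
          a *: (f x + g x : Y) + (f y + g y) :> Y).
  by rewrite lf lg scalerDr addrACA.
- move=> /asboolP lf; apply/asboolP => a x y.
  change (scalar_map A r *: (f (a *: x + y) : Y) =
     a *: (scalar_map A r *: (f x : Y)) + scalar_map A r *: (f y : Y)).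
  by rewrite lf scalerDr !scalerA scalar_map_central.
Qed.

Record module_hom := ModuleHom { hom_fun : X -> restrict Y; _ : hom_fun \in hom_pred }.
HB.instance Definition _ := [isSub for hom_fun].
HB.instance Definition _ := [Choice of module_hom by <:].
HB.instance Definition _ := GRing.SubChoice_isSubLmodule.Build
  R (X -> restrict Y)%type hom_pred module_hom hom_closed.

Definition hom_apply (f : module_hom) : X -> Y := hom_fun f.
Coercion hom_apply : module_hom >-> Funclass.

Lemma hom_is_linear (f : module_hom) : linear (f : X -> Y).
Proof. exact/asboolP/(valP f). Qed.
HB.instance Definition _ (f : module_hom) :=
  GRing.isLinear.Build A X Y *:%R (hom_apply f) (hom_is_linear f).

Lemma homP (f g : module_hom) : f =1 g -> f = g.
Proof. by move=> fg; apply/val_inj/funext. Qed.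

Lemma hom_applyD (f g : module_hom) x : (f + g) x = f x + g x.
Proof. by []. Qed.

Lemma hom_applyZ r (f : module_hom) x : (r *: f) x = scalar_map A r *: f x.
Proof. by []. Qed.
End Hom.

Section Precomposition.
Variables (R : pzRingType) (A : algebra R) (W X Y : lmodType A).
Variable d : {linear W -> X}.

Lemma precomp_subproof (f : module_hom X Y) :
  ((fun w => f (d w)) : W -> restrict Y) \in @hom_pred R A W Y.
Proof. by rewrite unfold_in; apply/asboolP => a x y; rewrite !linearP. Qed.

Definition precomp (f : module_hom X Y) : module_hom W Y := ModuleHom (precomp_subproof f).

Lemma precomp_is_linear : linear precomp.
Proof. by move=> r f g; apply: homP. Qed.
HB.instance Definition _ := GRing.isLinear.Build R (module_hom X Y) (module_hom W Y) *:%R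
  precomp precomp_is_linear.
End Precomposition.

(* The standard free resolution ... -> P_1 -> P_0 -> X -> 0: P_n is free on the
   underlying set of the n-th syzygy, P_0 -> X is evaluation, and P_(n+1) -> P_n
   is evaluation onto the (n+1)-st syzygy, a submodule of P_n. *)
Section FreeResolution.
Variables (A : pzRingType) (X : lmodType A).

Fixpoint syzygy (n : nat) : lmodType A :=
  if n is m.+1 then kernel (free_lift (@id (syzygy m))) else X.

Definition resolution (n : nat) : lmodType A := free_module A (syzygy n).

Definition differential (n : nat) : resolution n.+1 -> resolution n :=
  fun z => val (free_lift (@id (syzygy n.+1)) z).
Arguments differential : clear implicits.

Lemma differential_is_linear n : linear (differential n).
Proof. by move=> a x y; rewrite /differential !linearP. Qed.
HB.instance Definition _ n := GRing.isLinear.Build A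
  (resolution n.+1) (resolution n) *:%R (differential n)
  (@differential_is_linear n).
End FreeResolution.
Arguments differential {A} X n.

(* The cohomology of Hom_A(P_0, Y) -> Hom_A(P_1, Y) -> Hom_A(P_2, Y) at
   Hom_A(P_1, Y), for the free resolution P of X above. *)
Definition Ext1 (R : pzRingType) (A : algebra R) (X Y : lmodType A) :
    lmodType R :=
  homology (precomp (Y := Y) (differential X 0))
           (precomp (Y := Y) (differential X 1)).

Definition rigid (R : pzRingType) (A : algebra R) (X : lmodType A) : Prop :=
  forall e : Ext1 X X, e = 0.

Definition lattice (R : pzRingType) (A : algebra R) (X : lmodType A) : Prop :=
  fg_projective (restrict X).

Record quiver := Quiver {
  vertex : finType;
  arrow : finType;
  head : arrow -> vertex;
  tail : arrow -> vertex
}.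

Section Paths.
Variable Q : quiver.

Fixpoint is_path (i : vertex Q) (s : seq (arrow Q)) : bool :=
  if s is a :: s' then (tail a == i) && is_path (head a) s' else true.

Definition endpoint (i : vertex Q) (s : seq (arrow Q)) : vertex Q :=
  last i [seq head a | a <- s].

(* (i, [:: a1; ...; an]) is the path that starts at i and traverses a1 first
   and an last; as an element of the path algebra it is an * ... * a1, and
   (i, [::]) is the trivial path e_i. *)
Definition qpath : Type :=
  {w : vertex Q * seq (arrow Q) | is_path w.1 w.2}.
HB.instance Definition _ := Choice.on qpath.

Definition source (p : qpath) : vertex Q := (val p).1.
Definition arrows (p : qpath) : seq (arrow Q) := (val p).2.

Lemma is_path_cat i s1 s2 :
  is_path i (s1 ++ s2) = is_path i s1 && is_path (endpoint i s1) s2.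
Proof.
by elim: s1 i => //= a s1 IH i; rewrite IH andbA.
Qed.

Lemma path_take_subproof (k : nat) (p : qpath) :
  is_path (source p) (take k (arrows p)).
Proof.
have := valP p; rewrite -/(source p) -/(arrows p) -{1}(cat_take_drop k (arrows p)).
by rewrite is_path_cat => /andP[].
Qed.

Lemma path_drop_subproof (k : nat) (p : qpath) :
  is_path (endpoint (source p) (take k (arrows p))) (drop k (arrows p)).
Proof.
have := valP p; rewrite -/(source p) -/(arrows p) -{1}(cat_take_drop k (arrows p)).
by rewrite is_path_cat => /andP[].
Qed.

Definition path_take (k : nat) (p : qpath) : qpath :=
  Sub (source p, take k (arrows p)) (path_take_subproof k p).

Definition path_drop (k : nat) (p : qpath) : qpath :=
  Sub (endpoint (source p) (take k (arrows p)), drop k (arrows p))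
      (path_drop_subproof k p).

Definition path_length (p : qpath) : nat := size (arrows p).

Lemma path_eq (p q : qpath) : source p = source q -> arrows p = arrows q -> p = q.
Proof.
move=> es ea; apply: val_inj; rewrite [val p]surjective_pairing.
by rewrite [val q]surjective_pairing -!/(source _) -!/(arrows _) es ea.
Qed.

Lemma path_length_take k p :
  (k <= path_length p)%N -> path_length (path_take k p) = k.
Proof. exact: size_takel. Qed.

Lemma path_length_drop k p : path_length (path_drop k p) = (path_length p - k)%N.
Proof. exact: size_drop. Qed.

Lemma endpoint_cat i s1 s2 : endpoint i (s1 ++ s2) = endpoint (endpoint i s1) s2.
Proof. by rewrite /endpoint map_cat last_cat. Qed.

Lemma path_drop_drop j k p : path_drop j (path_drop k p) = path_drop (j + k) p.
Proof.
apply: path_eq; last by rewrite /arrows /= drop_drop.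
by rewrite /source /= -endpoint_cat addnC takeD.
Qed.

Lemma path_take_take j k p : (k <= j)%N -> path_take k (path_take j p) = path_take k p.
Proof. by move=> kj; apply: path_eq => //; rewrite /arrows /= take_takel. Qed.

Lemma path_take_drop j k p : path_take j (path_drop k p) = path_drop k (path_take (j + k) p).
Proof.
apply: path_eq; rewrite /source /arrows /=; last by rewrite take_drop.
by rewrite take_takel ?leq_addl.
Qed.

Lemma path_take_all p : path_take (path_length p) p = p.
Proof. by apply: path_eq => //; rewrite /arrows /= take_size. Qed.

Lemma path_drop0 p : path_drop 0 p = p.
Proof. by apply: path_eq; rewrite /source /arrows /= ?take0 ?drop0. Qed.
End Paths.

(* The product of paths p q is "q followed by p", and vanishes unless p starts
   where q ends; hence the coefficient of a path w in f * g is the sum of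
   f w'' * g w' over the decompositions of w as w' followed by w''. *)
Section PathRing.
Variables (R : comNzRingType) (Q : quiver).

Definition path_ring : Type := free_module R (qpath Q).
HB.instance Definition _ := GRing.Lmodule.on path_ring.

Definition path_ring_coef (f : path_ring) (p : qpath Q) : R := coef f p.
Local Coercion path_ring_coef : path_ring >-> Funclass.

Lemma path_ringP (f g : path_ring) : f =1 g -> f = g.
Proof. by move=> fg; apply/val_inj/funext. Qed.

Lemma path_one_subproof :
  (fun p : qpath Q => (arrows p == [::])%:R) \in @finsupp_pred R (qpath Q).
Proof.
rewrite unfold_in; apply/asboolP.
have : finite_set [set (Sub (i, [::]) isT : qpath Q) | i in [set: vertex Q]].
  exact/finite_image/finite_finset.
apply: sub_finite_set => p /= nz; exists (source p) => //; apply: path_eq => //.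
by apply/esym/eqP; apply: contraNT nz => /negbTE->.
Qed.

Definition path_one : path_ring := FreeModule path_one_subproof.

Lemma path_mul_subproof (f g : path_ring) :
  (fun p => \sum_(k < (path_length p).+1) f (path_drop k p) * g (path_take k p))
    \in @finsupp_pred R (qpath Q).
Proof.
rewrite unfold_in; apply/asboolP.
pose comp (u v : qpath Q) : qpath Q :=
  insubd v (source v, arrows v ++ arrows u).
have := finite_image2 comp (coef_finite f) (coef_finite g).
apply: sub_finite_set => p /= nz.
have [[k fgk]|none] := pselect (exists k, f (path_drop k p) * g (path_take k p) != 0).
  exists (path_drop k p) => /=.
    by apply: contra_neq fgk => f0; rewrite /path_ring_coef f0 mul0r.
  exists (path_take k p) => /=.
    by apply: contra_neq fgk => g0; rewrite /path_ring_coef g0 mulr0.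
  have e : (source (path_take k p), arrows (path_take k p) ++ arrows (path_drop k p))
           = val p.
    by rewrite /source /arrows /= cat_take_drop -surjective_pairing.
  by apply: val_inj; rewrite /comp e valKd.
case/eqP: nz; apply: big1 => k _; apply/eqP/negPn/negP => fgk; apply: none.
by exists k.
Qed.

Definition path_mul (f g : path_ring) : path_ring :=
  FreeModule (path_mul_subproof f g).

Lemma path_mulE f g p : path_mul f g p =
  \sum_(0 <= k < (path_length p).+1) f (path_drop k p) * g (path_take k p).
Proof. by rewrite big_mkord. Qed.

Lemma path_ringD (f g : path_ring) p : path_ring_coef (f + g) p = f p + g p.
Proof. by []. Qed.

Lemma path_ringZ r (f : path_ring) p : path_ring_coef (r *: f) p = r * f p.
Proof. by []. Qed.

Lemma path_oneE p : path_one p = (path_length p == 0)%:R.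
Proof. by rewrite /path_length size_eq0. Qed.

Lemma path_mulA : associative path_mul.
Proof.
move=> f g h; apply: path_ringP => p; rewrite !path_mulE; set n := path_length p.
pose F j k := f (path_drop (j + k) p) * g (path_take j (path_drop k p))
              * h (path_take k p).
transitivity (\sum_(0 <= k < n.+1) \sum_(0 <= j < n.+1 - k) F j k); last first.
  apply: eq_big_nat => k /andP[_ kn]; rewrite path_mulE path_length_drop big_distrl.
  by rewrite -subSn //; apply: eq_bigr => j _; rewrite /F path_drop_drop.
transitivity (\sum_(0 <= m < n.+1) \sum_(0 <= k < n.+1 | (k <= m)%N) F (m - k)%N k).
  apply: eq_big_nat => m /andP[_ mn].
  rewrite path_mulE path_length_take // big_distrr /=.
  rewrite [RHS](@big_cat_nat _ _ _ m.+1) //= [X in _ + X]big_nat_cond.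
  rewrite [X in _ + X]big_pred0 ?addr0 => [|k]; last first.
    by case: (ltnP m k); rewrite ?andbF //= => /ltnW; case: leqP.
  rewrite [RHS]big_nat_cond big_nat_cond.
  apply: eq_big => k; first by rewrite /= ltnS; case: leqP; rewrite ?andbF.
  move=> /andP[/andP[_ km] _]; rewrite /F subnK // path_take_take //.
  by rewrite path_take_drop subnK // mulrA.
rewrite (exchange_big_dep_nat xpredT) //=; apply: eq_big_nat => k /andP[_ kn].
rewrite (@big_cat_nat _ _ _ k) //=; last exact: ltnW.
rewrite big_nat_cond big_pred0 ?add0r => [|m]; last first.
  by case: (leqP k m); rewrite ?andbF.
rewrite -[in LHS](add0n k) big_addn [RHS]big_nat_cond big_nat_cond.
apply: eq_big => j; first by rewrite leq_addl.
by rewrite addnK.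
Qed.

Lemma path_mul1l : left_id path_one path_mul.
Proof.
move=> f; apply: path_ringP => p; rewrite path_mulE big_nat_recr // big_nat_cond.
rewrite big1 => [|k /andP[/andP[_ kp] _]].
  by rewrite [LHS]Monoid.mul1m path_oneE path_length_drop subnn eqxx mul1r path_take_all.
by rewrite path_oneE path_length_drop subn_eq0 leqNgt kp mul0r.
Qed.

Lemma path_mul1r : right_id path_one path_mul.
Proof.
move=> f; apply: path_ringP => p; rewrite path_mulE big_nat_recl // big_nat_cond.
rewrite big1 => [|k /andP[/andP[_ kp] _]].
  by rewrite [LHS]Monoid.mulm1 path_oneE path_length_take // eqxx mulr1 path_drop0.
by rewrite path_oneE path_length_take // mulr0.
Qed.

Lemma path_mulDl : left_distributive path_mul +%R.
Proof.
move=> f g h; apply: path_ringP => p; rewrite path_ringD !path_mulE -big_split.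
by apply: eq_bigr => k _; rewrite path_ringD mulrDl.
Qed.

Lemma path_mulDr : right_distributive path_mul +%R.
Proof.
move=> f g h; apply: path_ringP => p; rewrite path_ringD !path_mulE -big_split.
by apply: eq_bigr => k _; rewrite path_ringD mulrDr.
Qed.

HB.instance Definition _ := GRing.Zmodule_isPzRing.Build path_ring
  path_mulA path_mul1l path_mul1r path_mulDl path_mulDr.

Lemma path_scaleAl r (f g : path_ring) : r *: (f * g) = (r *: f) * g.
Proof.
apply: path_ringP => p; rewrite path_ringZ !path_mulE big_distrr.
by apply: eq_bigr => k _; rewrite path_ringZ; exact: mulrA.
Qed.

Lemma path_scaleAr r (f g : path_ring) : r *: (f * g) = f * (r *: g).
Proof.
apply: path_ringP => p; rewrite path_ringZ !path_mulE big_distrr.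
by apply: eq_bigr => k _; rewrite path_ringZ; exact: mulrCA.
Qed.

Definition path_scalar (r : R) : path_ring := r *: (1 : path_ring).

Lemma path_scalar_zmod : zmod_morphism path_scalar.
Proof. by move=> r s; rewrite /path_scalar scalerBl. Qed.

Lemma path_scalar_monoid : monoid_morphism path_scalar.
Proof.
split; first exact: scale1r.
by move=> r s; rewrite /path_scalar -path_scaleAl mul1r scalerA.
Qed.

HB.instance Definition _ :=
  GRing.isZmodMorphism.Build R path_ring path_scalar path_scalar_zmod.
HB.instance Definition _ :=
  GRing.isMonoidMorphism.Build R path_ring path_scalar path_scalar_monoid.

Lemma path_scalar_central r (f : path_ring) : path_scalar r * f = f * path_scalar r.
Proof. by rewrite /path_scalar -path_scaleAl -path_scaleAr mul1r mulr1. Qed.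

Lemma path_elem_subproof (p : qpath Q) :
  (fun w : qpath Q => (w == p)%:R) \in @finsupp_pred R (qpath Q).
Proof.
rewrite unfold_in; apply/asboolP.
apply: sub_finite_set (finite_set1 p) => w /= nz.
by apply/eqP; apply: contraNT nz => /negbTE->.
Qed.

Definition path_elem (p : qpath Q) : path_ring :=
  FreeModule (path_elem_subproof p).

Lemma path_elem_mul (p q w : qpath Q) :
  path_ring_coef (path_elem p * path_elem q) w =
  ((endpoint (source q) (arrows q) == source p) &&
   (val w == (source q, arrows q ++ arrows p)))%:R.
Proof.
rewrite [LHS]path_mulE; set n := path_length q.
have termE k : path_elem p (path_drop k w) * path_elem q (path_take k w) =
    ((path_drop k w == p) && (path_take k w == q))%:R.
  by rewrite -mulnb natrM.
rewrite (eq_bigr _ (fun k _ => termE k)).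
have takeE k : (k <= path_length w)%N -> path_take k w = q -> k = n.
  by move=> kw e; rewrite /n -e path_length_take.
have -> : (endpoint (source q) (arrows q) == source p) &&
          (val w == (source q, arrows q ++ arrows p)) =
          (n < (path_length w).+1)%N && ((path_drop n w == p) && (path_take n w == q)).
  apply/andP/and3P => [[/eqP es /eqP ew]|[nw /eqP dw /eqP tw]].
    have ws : source w = source q by rewrite /source ew.
    have wa : arrows w = arrows q ++ arrows p by rewrite /arrows ew.
    rewrite ltnS /path_length wa size_cat leq_addr; split=> //; apply/eqP.
      apply: path_eq.
        rewrite -[LHS]/(endpoint (source w) (take n (arrows w))).
        by rewrite ws wa take_size_cat.
      by rewrite -[LHS]/(drop n (arrows w)) wa drop_size_cat.
    apply: path_eq => //.
    by rewrite -[LHS]/(take n (arrows w)) wa take_size_cat.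
  have <- : path_drop n w = p by []; have {3 4}<- : path_take n w = q by [].
  split; apply/eqP; first by rewrite -{1 2}tw.
  by rewrite /arrows /source /= cat_take_drop -surjective_pairing.
have [nw|wn] := ltnP n (path_length w).+1; last first.
  rewrite big_nat_cond big1 // => k /andP[/andP[_ kw] _].
  case: eqP => //= _; case: eqP => // /(takeE _ kw) kn.
  by move: kw; rewrite ltnNge kn wn.
rewrite (bigD1_seq n) ?mem_index_iota ?iota_uniq //= big_nat_cond.
rewrite big1 ?addr0 // => k /andP[/andP[_ kw] kn].
by case: eqP => //= _; case: eqP => // /(takeE _ kw) /eqP; rewrite (negbTE kn).
Qed.

Definition path_algebra : algebra R :=
  @MkAlgebra R path_ring path_scalar path_scalar_central.
End PathRing.

(* Main.v *)
Require Import Defs.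
From mathcomp Require Import all_boot all_algebra.
From HB Require Import structures.
From mathcomp Require Import boolp classical_sets cardinality.

(* Hom(X, Y) and Ext^1(X, Y) are the kernel and the cokernel of the map
     d : prod_i Hom_R(X_i, Y_i) -> prod_a Hom_R(X_t(a), Y_h(a)),
     d(G)_a = G_h(a) X_a - Y_a G_t(a)
   between finitely generated projective modules, so it suffices to find psi with
   d psi d = d.  The s in R with d psi d = s d for some psi form an ideal; if it were
   proper it would lie in a maximal ideal with residue field k, where a
   contradiction arises as soon as every homomorphism X_k -> Y_k lifts to X -> Y.

   To lift theta : X_k -> Y_k, lift its components to R-linear maps S that have
   quasi-inverses (rank factorization over k), and perturb X and Y to representations
   X' and Y', congruent to X and Y modulo the maximal ideal, for which S is an exact
   homomorphism X' -> Y'.  As X is rigid, d for the pair (X, X') is surjective near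
   the maximal ideal, so the identity of X_k lifts to X -> X'; likewise the identity
   of Y_k lifts to Y' -> Y.  The composite X -> X' -> Y' -> Y lifts theta. *)

Set Implicit Arguments.
Unset Strict Implicit.
Unset Printing Implicit Defensive.

Import GRing.Theory VectorInternalTheory.
Local Open Scope ring_scope.

(** * Residue fields *)

Section ResidueField.
Variables (R : comNzRingType) (I : {pred R}).
Hypotheses (I_closed : idealr_closed I).
(** Maximality is phrased as invertibility modulo [I] of every element outside [I]; properness of
    [I] is part of [idealr_closed]. *)
Definition maximal_ideal : Prop := forall x, x \notin I -> exists y, 1 - y * x \in I.
Hypothesis I_max : maximal_ideal.

(** The closure proof is an argument of the alias, so that the ideal structure attached to it can
    depend on that proof; [residue_type] carries the maximality proof for the same reason. *)
Definition ideal_pred of idealr_closed I : {pred R} := I.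
Local Notation J := (ideal_pred I_closed).
HB.instance Definition _ := isIdealr.Build R J I_closed.

Definition residue_type of maximal_ideal : Type := Quotient.quot J.
Local Notation residue_field := (residue_type I_max).
HB.instance Definition _ := GRing.ComNzRing.on residue_field.

Definition residue (x : R) : residue_field := \pi_(Quotient.quot J)%qT x.

Lemma residue_zmod_morphism : zmod_morphism residue.
Proof. by move=> x y; exact: (raddfB (\pi_(Quotient.quot J)%qT)). Qed.

Lemma residue_monoid_morphism : monoid_morphism residue.
Proof.
split=> [|x y]; first exact: (rmorph1 (\pi_(Quotient.quot J)%qT)).
exact: (rmorphM (\pi_(Quotient.quot J)%qT)).
Qed.
HB.instance Definition _ :=
  GRing.isZmodMorphism.Build R residue_field residue residue_zmod_morphism.
HB.instance Definition _ :=
  GRing.isMonoidMorphism.Build R residue_field residue residue_monoid_morphism.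

Lemma residue_eq0 x : (residue x == 0) = (x \in I).
Proof.
rewrite -(raddf0 residue).
by have := Quotient.idealrBE J x 0; rewrite subr0 => e; apply/esym.
Qed.

Lemma residue_surj (u : residue_field) : exists x, residue x = u.
Proof. by exists (repr (u : Quotient.quot J)); exact: reprK. Qed.

Lemma residue_inv (u : residue_field) :
  exists v, (u != 0 -> v * u = 1) /\ (u = 0 -> v = 0).
Proof.
have [x <-] := residue_surj u.
have [xI|xI] := boolP (x \in I).
  by exists 0; rewrite residue_eq0 xI.
have [y yx] := I_max xI; exists (residue y); split=> [_|/eqP].
  by apply/eqP; rewrite -rmorphM eq_sym -subr_eq0 -(rmorph1 residue) -rmorphB residue_eq0.
by rewrite residue_eq0 (negbTE xI).
Qed.

Definition residue_invr (u : residue_field) : residue_field :=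
  projT1 (cid (residue_inv u)).

Lemma residue_mulVr u : u != 0 -> residue_invr u * u = 1.
Proof. by rewrite /residue_invr; case: cid => v /= []. Qed.

Lemma residue_invr0 : residue_invr 0 = 0.
Proof. by rewrite /residue_invr; case: cid => v /= [_ ->]. Qed.

HB.instance Definition _ := GRing.ComNzRing_isField.Build residue_field
  residue_mulVr residue_invr0.
End ResidueField.

Lemma proper_ideal_residue (R : comNzRingType) (S : R -> Prop) :
    S 0 -> (forall x y, S x -> S y -> S (x + y)) ->
    (forall a x, S x -> S (a * x)) -> ~ S 1 ->
  exists (k : fieldType) (eps : {rmorphism R -> k}),
    (forall u, exists x, eps x = u) /\ (forall x, S x -> eps x = 0).
Proof.
move=> S0 SD SM S1.
pose ideal (T : set R) := [/\ S `<=` T, forall x y, T x -> T y -> T (x + y),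
  forall a x, T x -> T (a * x) & ~ T 1]%classic.
have idS : ideal S by split.
have [|T [idT Tmax]] := @Zorn_bigcup R (fun T => T = set0 \/ ideal T).
  move=> F Fid Ftot.
  have [[T0 [FT0 idT0]]|none] := pselect (exists T, F T /\ ideal T); last first.
    left; rewrite -subset0 => x [T FT Tx]; apply: none; exists T; split => //.
    by have [T0|//] := Fid _ FT; rewrite T0 in Tx.
  right; split.
  - by move=> x Sx; exists T0 => //; case: idT0 => ST0 _ _ _; apply: ST0.
  - move=> x y [T FT Tx] [U FU Uy].
    have [TU|UT] := Ftot _ _ FT FU.
      exists U => //; have [U0|[_ UD _ _]] := Fid _ FU; first by rewrite U0 in Uy.
      by apply: UD => //; apply: TU.
    exists T => //; have [U0|[_ UD _ _]] := Fid _ FT; first by rewrite U0 in Tx.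
    by apply: UD => //; apply: UT.
  - move=> a x [T FT Tx]; exists T => //.
    have [U0|[_ _ UM _]] := Fid _ FT; first by rewrite U0 in Tx.
    exact: UM.
  - move=> [T FT T1]; have [U0|[_ _ _]] := Fid _ FT; first by rewrite U0 in T1.
    exact.
have {idT} [ST TD TM T1] : ideal T.
  case: idT => // T0; case: (Tmax S); last by right.
  by split; rewrite T0 //; move=> S_sub; exact: (S_sub 0).
have T0 : T 0 by exact: ST.
pose TI : {pred R} := fun x => `[< T x >].
have mem_T x : (x \in TI) = `[< T x >] by [].
have Tid : idealr_closed TI.
  split; rewrite ?mem_T; [exact/asboolP|exact/asboolP|move=> a x y].
  by rewrite !mem_T => /asboolP Tx /asboolP Ty; apply/asboolP; apply/TD/Ty/TM.
have Tmax' x : x \notin TI ->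
    exists y, 1 - y * x \in TI.
  rewrite mem_T => /asboolP nTx; apply: contrapT => none.
  (* [U] is the ideal generated by [T] and [x]. If it contained 1, the coefficient of [x] would be
     an inverse of [x] modulo [T]. *)
  pose U := [set z | exists2 y, T y & exists a, z = y + a * x]%classic.
  apply: (Tmax U).
    split; first by move=> y Ty; exists y => //; exists 0; rewrite mul0r addr0.
    by move=> UT; apply/nTx/UT; exists 0 => //; exists 1; rewrite add0r mul1r.
  right; split.
  - by move=> y Sy; exists y; [exact: ST|exists 0; rewrite mul0r addr0].
  - move=> _ _ [y Ty [a ->]] [z Tz [b ->]]; exists (y + z); first exact: TD.
    by exists (a + b); rewrite mulrDl addrACA.
  - move=> c _ [y Ty [a ->]]; exists (c * y); first exact: TM.
    by exists (c * a); rewrite mulrDr mulrA.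
  - move=> [y Ty [a e]]; apply: none; exists a; rewrite mem_T; apply/asboolP.
    by rewrite e addrK.
exists (residue_type Tid Tmax'), (residue Tid Tmax').
split=> [u|x Sx]; first exact: residue_surj.
by apply/eqP; rewrite residue_eq0 mem_T; apply/asboolP/ST.
Qed.

(** * Linear algebra modulo a maximal ideal *)

Definition to_linear (R : pzRingType) (U V : lmodType R) (f : U -> V) (lf : linear f) :
  {linear U -> V} := HB.pack f (GRing.isLinear.Build R U V *:%R f lf).

Section ModuloIdeal.
Variables (R : comNzRingType) (k : fieldType) (eps : {rmorphism R -> k}).
Hypothesis eps_surj : forall u, exists x, eps x = u.

(** For finite free [V] this is membership in [ker eps] times [V]. Testing with functionals needs no
    basis and makes stability under linear maps immediate. *)
Definition vanishing (V : lmodType R) (v : V) : Prop :=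
  forall l : {linear V -> R^o}, eps (l v) = 0.

Section Vanishing.
Variables V W : lmodType R.

Lemma vanishing_linear (f : {linear V -> W}) v : vanishing v -> vanishing (f v).
Proof. by move=> v0 l; exact: (v0 (l \o f)). Qed.

Lemma vanishingD (u v : V) : vanishing u -> vanishing v -> vanishing (u + v).
Proof. by move=> u0 v0 l; rewrite linearD rmorphD u0 v0 addr0. Qed.

Lemma vanishingZ a (v : V) : vanishing v -> vanishing (a *: v).
Proof. by move=> v0 l; rewrite linearZ rmorphM v0 mulr0. Qed.

Lemma vanishingN (v : V) : vanishing v -> vanishing (- v).
Proof. by rewrite -scaleN1r; exact: vanishingZ. Qed.

Lemma vanishing_scalar a (v : V) : eps a = 0 -> vanishing (a *: v).
Proof. by move=> a0 l; rewrite linearZ rmorphM a0 mul0r. Qed.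

Lemma vanishing_sum (I : finType) (F : I -> V) :
  (forall i, vanishing (F i)) -> vanishing (\sum_i F i).
Proof.
move=> F0; elim/big_rec: _ => [l|i v _]; first by rewrite linear0 rmorph0.
exact: vanishingD.
Qed.
End Vanishing.

Lemma vanishing_mx p q (M : 'M[R]_(p, q)) : vanishing M <-> map_mx eps M = 0.
Proof.
split=> [M0|M0].
  apply/matrixP=> i j; rewrite !mxE.
  have lf : linear (fun M : 'M[R]_(p, q) => M i j : R^o).
    by move=> a A B; rewrite !mxE.
  exact: (M0 (to_linear lf)).
rewrite (matrix_sum_delta M); apply: vanishing_sum => i.
apply: vanishing_sum => j; apply: vanishing_scalar.
by have /matrixP/(_ i j) := M0; rewrite !mxE.
Qed.

Lemma vanishing_ffun (J : finType) (V : lmodType R) (z : {ffun J -> V}) :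
  vanishing z <-> forall a, vanishing (z a).
Proof.
split=> [z0 a|z0].
  have lf : linear (fun z : {ffun J -> V} => z a) by move=> b u v; rewrite !ffunE.
  exact: (vanishing_linear (to_linear lf)).
have lf a : linear (fun v : V => [ffun b => if b == a then v else 0] : {ffun J -> V}).
  move=> b u v; apply/ffunP=> c; rewrite !ffunE.
  by case: eqP => _ //; rewrite scaler0 addr0.
have -> : z = \sum_a to_linear (lf a) (z a).
  apply/ffunP=> b; rewrite sum_ffunE (bigD1 b) //= ffunE eqxx big1 ?addr0 // => a ab.
  by rewrite ffunE eq_sym (negbTE ab).
by apply: vanishing_sum => a; apply: vanishing_linear.
Qed.

Lemma lift_mx p q (N : 'M[k]_(p, q)) : exists M : 'M[R]_(p, q), map_mx eps M = N.
Proof.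
have [f fP] := choice eps_surj; exists (map_mx f N).
by apply/matrixP=> i j; rewrite !mxE fP.
Qed.

(* The adjugate is a quasi-inverse whose defect [\det] is [1] modulo the ideal;
   it replaces Nakayama's lemma over the localization. *)
Lemma near_identity_inverse (V : vectType R) (T : {linear V -> V}) :
    (forall v, vanishing (T v - v)) ->
  exists (s : R) (T' : {linear V -> V}),
    [/\ eps s = 1, forall v, T (T' v) = s *: v & forall v, T' (T v) = s *: v].
Proof.
move=> T1; pose M : 'M[R]_(dim V) := lin1_mx (v2r \o T \o r2v).
have TM v : v2r (T v) = v2r v *m M by rewrite mul_rV_lin1 /= v2rK.
have M1 : map_mx eps M = 1%:M.
  apply/row_matrixP=> i; apply/eqP; rewrite -subr_eq0 !rowE mulmx1 -(map_delta_mx eps).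
  rewrite -map_mxM -map_mxB; apply/eqP/vanishing_mx.
  pose e : V := r2v (delta_mx 0 i : 'rV_(dim V)).
  have -> : delta_mx 0 i *m M - delta_mx 0 i = v2r (T e - e).
    by rewrite linearB /= TM !r2vK.
  exact: vanishing_linear.
have lf : linear (fun v : V => r2v (v2r v *m \adj M)).
  by move=> a u v; rewrite !linearP mulmxDl -scalemxAl !linearP.
exists (\det M), (to_linear lf); split=> [|v|v] /=.
- by rewrite -det_map_mx M1 det1.
- by apply: v2r_inj; rewrite TM r2vK -mulmxA mul_adj_mx mul_mx_scalar linearZ.
- by apply: v2r_inj; rewrite r2vK TM -mulmxA mul_mx_adj mul_mx_scalar linearZ.
Qed.

(** [W] is free, so it is enough to choose preimages on a basis. The map [p] is general so that it
    can be a projection onto a summand, where [f] is onto only that summand. *)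
Lemma linear_section (V U : lmodType R) (W : vectType R) (f : {linear V -> U})
    (p : {linear W -> U}) :
  (forall w, exists v, f v = p w) ->
  exists s : {linear W -> V}, forall w, f (s w) = p w.
Proof.
move=> /choice[g fg].
pose s (w : W) : V :=
  \sum_(i < dim W) (v2r w) 0 i *: g (r2v (delta_mx 0 i : 'rV_(dim W))).
have ls : linear s.
  move=> a u v; rewrite /s scaler_sumr -big_split; apply: eq_bigr => i _ /=.
  by rewrite linearP !mxE scalerDl scalerA.
exists (to_linear ls) => w; rewrite -[w in RHS]v2rK [v2r w in RHS]row_sum_delta.
by rewrite !linear_sum; apply: eq_bigr => i _; rewrite !linearZ fg.
Qed.
End ModuloIdeal.

Lemma rank_factorization (k : fieldType) p q (M : 'M[k]_(p, q)) :
  exists r (u : 'M_(p, r)) (v : 'M_(r, q)) (u' : 'M_(r, p)) (v' : 'M_(q, r)),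
    [/\ u *m v = M, u' *m u = 1%:M & v *m v' = 1%:M].
Proof.
exists (\rank M), (col_base M), (row_base M), (pinvmx (col_base M)).
exists (pinvmx (row_base M)).
split; first exact: mulmx_base.
  exact/mulVpmx/col_base_full.
exact/mulmxVp/row_base_free.
Qed.

(** * Quasi-inverses obtained from rank factorizations over the residue field *)

Section RankLifting.
Variables (R : comNzRingType) (k : fieldType) (eps : {rmorphism R -> k}).
Hypothesis eps_surj : forall u, exists x, eps x = u.

(** Over the residue field, [1 - u0 c0] projects onto the row kernel of [M0]. The hypothesis lifts
    it to a matrix [K] with [K M = 0]. Up to a factor that is 1 modulo the ideal, [M] then factors
    through the [r] rows of [c M], and [c M] has the right quasi-inverse [w]. *)
Lemma lifted_kernel_mx p q (M : 'M[R]_(p, q)) :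
    (forall u : 'rV_p, map_mx eps (u *m M) = 0 ->
       exists u' : 'rV_p, u' *m M = 0 /\ map_mx eps u' = map_mx eps u) ->
  exists s (N : 'M_(q, p)), eps s = 1 /\ M *m N *m M = s *: M.
Proof.
move=> lift_ker; set M0 := map_mx eps M.
have [r [u0 [v0 [c0 [w0 [uvE cu1 vw1]]]]]] := rank_factorization M0.
have [u uE] := lift_mx eps_surj u0.
have [c cE] := lift_mx eps_surj c0.
have [w wE] := lift_mx eps_surj w0.
have rows_ker i : exists u', u' *m M = 0 /\
    map_mx eps u' = map_mx eps (row i (1%:M - u *m c)).
  apply: lift_ker; rewrite -row_mul map_row.
  rewrite mulmxBl mul1mx map_mxB !map_mxM uE cE -/M0.
  rewrite -uvE -!mulmxA (mulmxA c0) cu1 mul1mx.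
  by rewrite subrr row0.
have [f fP] := choice rows_ker; pose K := \matrix_i f i.
have KM : K *m M = 0.
  by apply/row_matrixP=> i; rewrite row_mul rowK (fP i).1 row0.
have KE : map_mx eps K = 1%:M - u0 *m c0.
  apply/row_matrixP=> i; rewrite -map_row rowK (fP i).2 map_row.
  by rewrite map_mxB map_mxM map_mx1 uE cE.
(* Modulo the ideal, [U] is the sum of the two complementary projections, while [U M = u c M].
   Multiplying by the adjugate of [U] recovers [M] up to [\det U]. *)
pose U := K + u *m c; pose D := c *m M *m w.
have U1 : map_mx eps U = 1%:M.
  by rewrite map_mxD KE map_mxM uE cE subrK.
have D1 : map_mx eps D = 1%:M.
  by rewrite !map_mxM cE wE -/M0 -uvE mulmxA cu1 mul1mx.
have UM : \det U *: M = \adj U *m u *m (c *m M).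
  rewrite -mul_scalar_mx -mul_adj_mx -!mulmxA; congr (_ *m _).
  by rewrite mulmxDl KM add0r !mulmxA.
exists (\det D * \det U), (\det U *: (w *m \adj D *m c)); split.
  by rewrite rmorphM -!det_map_mx D1 U1 !det1 mulr1.
rewrite -scalemxAr -!scalemxAl.
transitivity ((\det U *: M) *m w *m \adj D *m (c *m M)).
  by rewrite -!scalemxAl !mulmxA.
rewrite UM -(mulmxA _ (c *m M)) -(mulmxA _ (c *m M *m w)) mul_mx_adj.
by rewrite mul_mx_scalar -scalemxAl -UM scalerA.
Qed.

Lemma lifted_kernel_regular (V W : vectType R) (phi : {linear V -> W}) :
    (forall v, vanishing eps (phi v) ->
       exists v', phi v' = 0 /\ vanishing eps (v' - v)) ->
  exists s (psi : {linear W -> V}),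
    eps s = 1 /\ forall v, phi (psi (phi v)) = s *: phi v.
Proof.
move=> lift_ker; pose M : 'M[R]_(dim V, dim W) := lin1_mx (v2r \o phi \o r2v).
have phiM v : v2r (phi v) = v2r v *m M by rewrite mul_rV_lin1 /= v2rK.
have [u uM|s [N [s1 NM]]] := @lifted_kernel_mx _ _ M.
  have [|v' [v'0 v'u]] := lift_ker (r2v u).
    rewrite -[phi _]v2rK phiM r2vK; apply: vanishing_linear.
    exact/vanishing_mx.
  exists (v2r v'); rewrite -phiM v'0 linear0; split=> //.
  apply/eqP; rewrite -subr_eq0 -map_mxB; apply/eqP/vanishing_mx.
  rewrite -[X in _ - X]r2vK -linearB; exact: vanishing_linear.
have lf : linear (fun w : W => r2v (v2r w *m N) : V).
  by move=> a x y; rewrite !linearP mulmxDl -scalemxAl !linearP.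
exists s, (to_linear lf); split=> // v; apply: v2r_inj.
by rewrite phiM /= r2vK linearZ /= !phiM -!mulmxA [M *m _]mulmxA NM -scalemxAr.
Qed.

(** [T] itself may have larger rank than its reduction, hence no quasi-inverse. Lifting the two
    factors of the rank factorization separately, and cutting them down by [E] and [F], keeps the
    lift [S] factored through rank [r]; the one-sided inverses of the factors lift up to the
    determinants of [P] and [Q]. *)
Lemma regular_lift n m (E : 'M[R]_n) (F : 'M[R]_m) (T : 'M[R]_(n, m)) :
    E *m E = E -> F *m F = F -> E *m T *m F = T ->
  exists (S : 'M[R]_(n, m)) (S' : 'M[R]_(m, n)) d,
    [/\ map_mx eps S = map_mx eps T, E *m S *m F = S, F *m S' *m E = S',
        S *m S' *m S = d *: S & eps d = 1].
Proof.
move=> EE FF ETF; set T0 := map_mx eps T.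
have [r [u0 [v0 [c0 [w0 [uvE cu1 vw1]]]]]] := rank_factorization T0.
have [u uE] := lift_mx eps_surj u0.
have [v vE] := lift_mx eps_surj v0.
have [u' u'E] := lift_mx eps_surj c0.
have [v' v'E] := lift_mx eps_surj w0.
have ET : E *m T = T by rewrite -ETF !mulmxA EE.
have TF : T *m F = T by rewrite -ETF -!mulmxA FF.
(* The corner condition on [T0] passes to its factors because [v0] is right invertible and [u0] is
   left invertible. *)
have Eu : map_mx eps E *m u0 = u0.
  rewrite -[LHS]mulmx1 -vw1 mulmxA -(mulmxA _ u0) uvE.
  by rewrite -map_mxM ET -/T0 -uvE -mulmxA vw1 mulmx1.
have vF : v0 *m map_mx eps F = v0.
  rewrite -[LHS]mul1mx -cu1 -mulmxA (mulmxA u0) uvE.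
  by rewrite -map_mxM TF -/T0 -uvE mulmxA cu1 mul1mx.
pose P := u' *m (E *m u); pose Q := v *m F *m v'.
have P1 : map_mx eps P = 1%:M by rewrite !map_mxM u'E uE Eu cu1.
have Q1 : map_mx eps Q = 1%:M by rewrite !map_mxM v'E vE vF vw1.
exists (E *m u *m (v *m F)), (F *m v' *m \adj Q *m \adj P *m u' *m E), (\det P * \det Q).
split.
- by rewrite !map_mxM uE vE Eu vF uvE.
- by rewrite !mulmxA EE -!mulmxA FF.
- by rewrite !mulmxA FF -!mulmxA EE.
- transitivity (E *m u *m (Q *m \adj Q) *m (\adj P *m P) *m (v *m F)).
    rewrite /P /Q !mulmxA -[in LHS](mulmxA _ F F) FF.
    by rewrite -[in LHS](mulmxA _ E E) EE.
  rewrite mul_mx_adj mul_adj_mx !mul_mx_scalar -!scalemxAl scalerA.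
  by [].
- by rewrite rmorphM -!det_map_mx P1 Q1 !det1 mulr1.
Qed.
End RankLifting.

(** * Representations by idempotent and arrow matrices *)

(* [E i] is the idempotent of the vertex [i] and [A a] the matrix of the arrow [a];
   matrices act on row vectors, so [A a] lies in [E (tl a) * M * E (hd a)]. *)
Section MatrixRepresentations.
Variables (R : comNzRingType) (I J : finType) (hd tl : J -> I).

Definition matrix_rep n (E : I -> 'M[R]_n) (A : J -> 'M[R]_n) : Prop :=
  (forall i, E i *m E i = E i) /\
  (forall a, E (tl a) *m A a = A a /\ A a *m E (hd a) = A a).

Section Differential.
Variables (n m : nat) (E : I -> 'M[R]_n) (A : J -> 'M[R]_n).
Variables (F : I -> 'M[R]_m) (B : J -> 'M[R]_m).

(** The projection onto the summand prod_a Hom_R(X_t(a), Y_h(a)) of a free module. *)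
Definition arrow_corner (z : {ffun J -> 'M[R]_(n, m)}) : {ffun J -> 'M[R]_(n, m)} :=
  [ffun a => E (tl a) *m z a *m F (hd a)].

Lemma arrow_corner_is_linear : linear arrow_corner.
Proof.
move=> c u v; apply/ffunP=> a; rewrite !ffunE.
by rewrite mulmxDr mulmxDl -scalemxAr -scalemxAl.
Qed.
HB.instance Definition _ := GRing.isLinear.Build R {ffun J -> 'M[R]_(n, m)}
  {ffun J -> 'M[R]_(n, m)} *:%R arrow_corner arrow_corner_is_linear.

(** The map [d] of the introduction, extended to all families of matrices: the idempotents cut [G]
    down to the vertex blocks, so that domain and codomain are free. *)
Definition rep_diff (G : {ffun I -> 'M[R]_(n, m)}) : {ffun J -> 'M[R]_(n, m)} :=
  [ffun a => A a *m G (hd a) *m F (hd a) - E (tl a) *m G (tl a) *m B a].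

Lemma rep_diff_is_linear : linear rep_diff.
Proof.
move=> c u v; apply/ffunP=> a; rewrite !ffunE.
rewrite !mulmxDr !mulmxDl -!scalemxAr -!scalemxAl scalerBr opprD.
by rewrite addrACA.
Qed.
HB.instance Definition _ := GRing.isLinear.Build R {ffun I -> 'M[R]_(n, m)}
  {ffun J -> 'M[R]_(n, m)} *:%R rep_diff rep_diff_is_linear.

Lemma arrow_corner_diff G : matrix_rep E A -> matrix_rep F B ->
  arrow_corner (rep_diff G) = rep_diff G.
Proof.
move=> [EE EA] [FF FB]; apply/ffunP=> a; rewrite !ffunE.
rewrite mulmxBr mulmxBl !mulmxA (EA a).1 EE -!mulmxA FF !mulmxA.
by rewrite -[X in _ - X]mulmxA (FB a).2.
Qed.

Lemma arrow_cornerK z : matrix_rep E A -> matrix_rep F B ->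
  arrow_corner (arrow_corner z) = arrow_corner z.
Proof.
move=> [EE _] [FF _]; apply/ffunP=> a; rewrite !ffunE.
by rewrite !mulmxA EE -!mulmxA FF.
Qed.
End Differential.

(** Ext^1 of the representation with itself is the cokernel of [rep_diff] inside the corner summand;
    this says that it vanishes. *)
Definition rigid_rep n (E : I -> 'M[R]_n) (A : J -> 'M[R]_n) : Prop :=
  forall z, exists G, rep_diff E A E A G = arrow_corner E E z.

Section ModuloIdeal.
Variables (k : fieldType) (eps : {rmorphism R -> k}).
Hypothesis eps_surj : forall u, exists x, eps x = u.
Local Notation "M ^e" := (map_mx eps M) (at level 2, format "M ^e").

Lemma eq_map_vanishing p q (M N : 'M[R]_(p, q)) :
  M^e = N^e <-> vanishing eps (M - N).
Proof.
rewrite vanishing_mx map_mxB; split=> [->|/eqP]; first exact: subrr.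
by rewrite subr_eq0 => /eqP.
Qed.

(** The identity family [E] has differential [A1 - A2], which is 0 modulo the ideal. Since [d] for
    the pair ([A1], [A2]) is a perturbation of a map onto the corner summand, this defect, up to a
    factor [s], is also the differential of some [w] that vanishes modulo the ideal; then [s E - w]
    is the homomorphism. *)
Lemma near_rigid_hom n (E : I -> 'M[R]_n) (A A1 A2 : J -> 'M[R]_n) :
    rigid_rep E A -> matrix_rep E A1 -> matrix_rep E A2 ->
    (forall a, (A1 a)^e = (A a)^e) -> (forall a, (A2 a)^e = (A a)^e) ->
  exists g : I -> 'M[R]_n,
    [/\ forall i, (g i)^e = (E i)^e, forall i, E i *m g i *m E i = g i &
        forall a, A1 a *m g (hd a) = g (tl a) *m A2 a].
Proof.
move=> rigA rep1 rep2 A1A A2A; have [EE EA1] := rep1; have [_ EA2] := rep2.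
have [sec secP] : exists s : {linear _ -> _}, forall z,
    rep_diff E A E A (s z) = arrow_corner E E z := linear_section rigA.
pose d := rep_diff E A1 E A2.
(* On the corner summand [T] is [d \o sec]. The complementary projection is added so that [T] is
   near the identity on the whole free module. *)
pose T : {linear {ffun J -> 'M[R]_n} -> _} := (d \o sec) \+ (idfun \- arrow_corner E E).
have TE z : T z = d (sec z) + (z - arrow_corner E E z) by [].
have T1 z : vanishing eps (T z - z).
  rewrite TE addrA addrAC addrK -secP; apply/vanishing_ffun => a.
  apply/vanishing_mx; rewrite !ffunE !map_mxB !map_mxM A1A A2A.
  by rewrite subrr.
have [s [T' [s1 TT' _]]] := near_identity_inverse T1.
pose z0 := d [ffun i => E i]; pose w := sec (T' z0).
have z0E a : z0 a = A1 a - A2 a.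
  by rewrite !ffunE (EA1 a).2 (EA1 a).2 EE (EA2 a).1.
(* [T] preserves the component outside the corner. As [T (T' z0)] lies in the corner, so does
   [T' z0], and [T] acts on it as [d \o sec]. *)
have cornerT z : T z - arrow_corner E E (T z) = z - arrow_corner E E z.
  rewrite TE linearD linearB /= arrow_corner_diff //.
  by rewrite (arrow_cornerK z rep1 rep1) subrr addr0 addrC addKr.
have dw : d w = s *: z0.
  have := TE (T' z0); rewrite TT' -cornerT TT' linearZ /= arrow_corner_diff //.
  by rewrite subrr addr0.
exists (fun i => s *: E i - E i *m w i *m E i); split=> [i|i|a].
- apply/eq_map_vanishing; rewrite addrAC -[X in _ - X + _]scale1r -scalerBl.
  apply: vanishingD; first by apply: vanishing_scalar; rewrite rmorphB s1 rmorph1 subrr.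
  apply/vanishingN/vanishing_mx.
  have /vanishing_ffun/(_ i)/vanishing_mx w0 : vanishing eps w.
    do 2!apply: vanishing_linear; apply/vanishing_ffun => a; rewrite z0E.
    by apply/eq_map_vanishing; rewrite A1A A2A.
  by rewrite !map_mxM w0 mulmx0 mul0mx.
- by rewrite mulmxBr mulmxBl -scalemxAr -scalemxAl !EE !mulmxA EE -!mulmxA EE.
- apply/eqP; rewrite -subr_eq0; apply/eqP.
  have := congr1 (fun z : {ffun J -> 'M[R]_n} => z a) dw.
  rewrite {1}/d /rep_diff [LHS]ffunE [RHS]ffunE z0E => dwa.
  rewrite mulmxBr mulmxBl -scalemxAr -scalemxAl !mulmxA (EA1 a).2 (EA2 a).1.
  rewrite -(mulmxA _ (E (tl a)) (A2 a)) (EA2 a).1 opprB (addrC (_ *m _)) addrACA.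
  by rewrite -scalerBr -dwa addrACA subrr addNr addr0.
Qed.

Lemma rep_hom_lift n m (E : I -> 'M[R]_n) A (F : I -> 'M[R]_m) B
    (T : I -> 'M[R]_(n, m)) :
    matrix_rep E A -> matrix_rep F B -> rigid_rep E A -> rigid_rep F B ->
    (forall i, E i *m T i *m F i = T i) ->
    (forall a, (A a *m T (hd a) - T (tl a) *m B a)^e = 0) ->
  exists G : I -> 'M[R]_(n, m),
    [/\ forall i, (G i)^e = (T i)^e, forall i, E i *m G i *m F i = G i &
        forall a, A a *m G (hd a) = G (tl a) *m B a].
Proof.
move=> repA repB rigA rigB ETF Tker.
have [EE EA] := repA; have [FF FB] := repB.
have [S /choice[S0 /choice[d SP]]] := choice (fun i =>
  regular_lift eps_surj (EE i) (FF i) (ETF i)).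
(* The scalars [d i] depend on the vertex; multiplying each quasi-inverse by the remaining ones
   gives all vertices the common scalar [c]. *)
pose c := \prod_i d i; pose S' i := (\prod_(j | j != i) d j) *: S0 i.
have SE i : (S i)^e = (T i)^e by case: (SP i).
have ES i : E i *m S i = S i by case: (SP i) => _ <- *; rewrite !mulmxA EE.
have SF i : S i *m F i = S i by case: (SP i) => _ <- *; rewrite -!mulmxA FF.
have FS' i : F i *m S' i = S' i.
  by case: (SP i) => _ _ e _ _; rewrite /S' -scalemxAr -e !mulmxA FF.
have S'E i : S' i *m E i = S' i.
  by case: (SP i) => _ _ e _ _; rewrite /S' -scalemxAl -e -!mulmxA EE.
have SS'S i : S i *m S' i *m S i = c *: S i.
  have [_ _ _ e _] := SP i; rewrite /S' -scalemxAr -scalemxAl e scalerA.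
  by rewrite [c](bigD1 i) //= mulrC.
have SS'Sr i : S i *m (S' i *m S i) = c *: S i by rewrite mulmxA.
have c1 : eps c = 1 by rewrite rmorph_prod big1 // => i _; case: (SP i).
clearbody S' c.
pose D a := A a *m S (hd a) - S (tl a) *m B a.
have D0 a : (D a)^e = 0.
  by rewrite -(Tker a) !map_mxB !map_mxM !SE.
have ED a : E (tl a) *m D a = D a by rewrite mulmxBr !mulmxA (EA a).1 ES.
have DF a : D a *m F (hd a) = D a by rewrite mulmxBl -!mulmxA (FB a).2 SF.
(* For [c = 1]: subtracting [D S'] from [A] leaves the defect [D - D S' S]. This has [S (tl a)] as a
   left factor, since [A S] is unchanged by [S' S], so it can be moved into [B] through [S']. The
   powers of [c] clear denominators. *)
pose A' a := (c * c) *: A a - c *: (D a *m S' (hd a)).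
pose B' a := (c * c) *: B a + S' (tl a) *m (c *: D a - D a *m S' (hd a) *m S (hd a)).
have repA' : matrix_rep E A'.
  split=> // a; rewrite /A'; split.
    by rewrite mulmxBr -!scalemxAr !mulmxA ED (EA a).1.
  by rewrite mulmxBl -!scalemxAl -mulmxA S'E (EA a).2.
have repB' : matrix_rep F B'.
  split=> // a; rewrite /B'; split.
    by rewrite mulmxDr -scalemxAr !mulmxA FS' (FB a).1.
  by rewrite mulmxDl -mulmxA mulmxBl -!scalemxAl DF (FB a).2 -!mulmxA SF.
have A'A a : (A' a)^e = (A a)^e.
  rewrite map_mxB !map_mxZ map_mxM D0 rmorphM c1 mulr1 scale1r.
  by rewrite mul0mx scaler0 subr0.
have B'B a : (B' a)^e = (B a)^e.
  rewrite map_mxD map_mxM map_mxB !map_mxZ !map_mxM D0 rmorphM c1 mulr1 scale1r.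
  by rewrite !mul0mx scaler0 subr0 mulmx0 addr0.
have A'S a : A' a *m S (hd a) = S (tl a) *m B' a.
  have dE : c *: D a - D a *m S' (hd a) *m S (hd a) =
      S (tl a) *m (B a *m S' (hd a) *m S (hd a) - c *: B a).
    rewrite /D !mulmxBl -!mulmxA SS'Sr mulmxBr -!scalemxAr scalerBr opprB.
    by rewrite addrC addrA subrK.
  rewrite /A' /B' mulmxBl mulmxDr -!scalemxAl -!scalemxAr dE !mulmxA SS'S.
  rewrite -scalemxAl -dE scalerBr scalerA addrA; congr (_ - _).
  by rewrite -scalerDr addrC subrK.
have [g [gE EgE gA]] := near_rigid_hom rigA repA repA' (fun=> erefl) A'A.
have [h [hF FhF hB]] := near_rigid_hom rigB repB' repB B'B (fun=> erefl).
exists (fun i => g i *m S i *m h i); split=> [i|i|a].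
- by rewrite !map_mxM gE hF -!map_mxM ES SF SE.
- have Eg : E i *m g i = g i by rewrite -EgE !mulmxA EE.
  have hFi : h i *m F i = h i by rewrite -FhF -!mulmxA FF.
  by rewrite !mulmxA Eg -!mulmxA hFi.
- rewrite !mulmxA gA -(mulmxA (g _)) A'S -(mulmxA _ (h _)) -hB.
  by rewrite !mulmxA.
Qed.

Lemma rep_diff_locally_regular n m (E : I -> 'M[R]_n) A (F : I -> 'M[R]_m) B :
    matrix_rep E A -> matrix_rep F B -> rigid_rep E A -> rigid_rep F B ->
  exists s (psi : {linear {ffun J -> 'M[R]_(n, m)} -> {ffun I -> 'M[R]_(n, m)}}),
    eps s = 1 /\ forall G, let d := rep_diff E A F B in d (psi (d G)) = s *: d G.
Proof.
move=> repA repB rigA rigB; have [EE EA] := repA; have [FF FB] := repB.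
apply: (lifted_kernel_regular eps_surj) => G G0.
pose T i := E i *m G i *m F i.
have [i|a|G' [G'T EG'F G'A]] := rep_hom_lift (T := T) repA repB rigA rigB.
- by rewrite /T !mulmxA EE -!mulmxA FF.
- have /vanishing_ffun/(_ a)/vanishing_mx <- := G0.
  rewrite ffunE /T !mulmxA (EA a).2.
  by rewrite -(mulmxA _ (F (tl a))) (FB a).1.
(* Only the vertex blocks of [G] are replaced; the other entries stay, so the new family is still
   congruent to [G]. *)
exists (G + [ffun i => G' i - T i]); split.
  rewrite linearD; apply/ffunP=> a; rewrite !ffunE !mulmxBr !mulmxBl.
  have EG' i : E i *m G' i = G' i by rewrite -EG'F !mulmxA EE.
  have AT : A a *m T (hd a) *m F (hd a) = A a *m G (hd a) *m F (hd a).
    by rewrite /T !mulmxA (EA a).2 -mulmxA FF.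
  have TB : E (tl a) *m T (tl a) *m B a = E (tl a) *m G (tl a) *m B a.
    by rewrite /T !mulmxA EE -mulmxA (FB a).1.
  rewrite AT TB EG' G'A -[_ *m B a *m F _]mulmxA (FB a).2.
  by rewrite opprB [X in _ + X]addrC [X in _ + X]addrA subrK addrA subrK subrr.
rewrite addrC addKr; apply/vanishing_ffun => i; rewrite ffunE.
exact/eq_map_vanishing.
Qed.

End ModuloIdeal.

Lemma rep_diff_regular n m (E : I -> 'M[R]_n) A (F : I -> 'M[R]_m) B :
    matrix_rep E A -> matrix_rep F B -> rigid_rep E A -> rigid_rep F B ->
  exists psi : {linear {ffun J -> 'M[R]_(n, m)} -> {ffun I -> 'M[R]_(n, m)}},
    forall G, let d := rep_diff E A F B in d (psi (d G)) = d G.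
Proof.
move=> repA repB rigA rigB; pose d : {linear _ -> _} := rep_diff E A F B.
pose S (s : R) :=
  exists psi : {linear {ffun J -> 'M[R]_(n, m)} -> {ffun I -> 'M[R]_(n, m)}}, forall G,
    d (psi (d G)) = s *: d G.
have [[psi psiP]|S1] := pselect (S 1).
  by exists psi => G /=; rewrite -[RHS]scale1r; exact: psiP.
have [|x y [f fP] [g gP]|a x [f fP]||k [eps [eps_surj eps0]]] :=
  @proper_ideal_residue R S.
- by exists \0 => G; rewrite /= linear0 scale0r.
- by exists (f \+ g) => G; rewrite /= linearD fP gP scalerDl.
- exists (a \*: f) => G; rewrite -scalerA -fP; exact: linearZ.
- exact: S1.
have [s [psi [s1 psiP]]] := rep_diff_locally_regular eps_surj repA repB rigA rigB.
by have /eqP := oner_neq0 k; case; rewrite -s1 eps0 //; exists psi.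
Qed.
End MatrixRepresentations.

(** * Modules over the path algebra *)

Section FreeModuleBasis.
Variables (A : pzRingType) (T : choiceType).

Lemma free_elem_subproof (t : T) :
  (fun u : T => (u == t)%:R) \in @finsupp_pred A T.
Proof.
rewrite unfold_in; apply/asboolP.
apply: sub_finite_set (finite_set1 t) => u /= nz.
by apply/eqP; apply: contraNT nz => /negbTE->.
Qed.

Definition free_elem (t : T) : free_module A T := FreeModule (free_elem_subproof t).

Lemma free_elemE t u : free_elem t u = (u == t)%:R.
Proof. by []. Qed.

Lemma free_moduleP (f g : free_module A T) : f =1 g -> f = g.
Proof. by move=> fg; apply/val_inj/funext. Qed.

Lemma free_support (f : free_module A T) :
  exists2 s : seq T, uniq s & forall t, f t != 0 -> t \in s.
Proof.
have /finite_seqP[s sE] := coef_finite f.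
exists (undup s) => [|t ft]; first exact: undup_uniq.
have : [set t | f t != 0]%classic t by [].
by rewrite sE mem_undup.
Qed.

Section Lift.
Variables (M : lmodType A).
Implicit Type h : T -> M.

Lemma free_lift_elem h t : free_lift h (free_elem t) = h t.
Proof.
rewrite (@free_liftE _ _ _ h _ [:: t]) // => [|u]; last first.
  by rewrite free_elemE inE; case: (u == t) => //; rewrite eqxx.
by rewrite big_seq1 free_elemE eqxx scale1r.
Qed.

Lemma free_liftD h1 h2 f :
  free_lift (fun t => h1 t + h2 t) f = free_lift h1 f + free_lift h2 f.
Proof.
have [s us sf] := free_support f.
rewrite !(free_liftE _ us sf) -big_split; apply: eq_bigr => t _ /=.
exact: scalerDr.
Qed.

Lemma linear_free_lift (N : lmodType A) (g : {linear M -> N}) h f :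
  g (free_lift h f) = free_lift (fun t => g (h t)) f.
Proof.
have [s us sf] := free_support f; rewrite !(free_liftE _ us sf) linear_sum.
by apply: eq_bigr => t _; rewrite linearZ.
Qed.
End Lift.

Lemma free_lift_id f : free_lift free_elem f = f.
Proof.
have [s us sf] := free_support f; rewrite (free_liftE _ us sf).
apply: free_moduleP => u.
have lf : linear (fun g : free_module A T => g u : A^o) by [].
have lfZ t : to_linear lf (f t *: free_elem t) = f t * (u == t)%:R by [].
transitivity (to_linear lf (\sum_(t <- s) f t *: free_elem t)) => //.
rewrite linear_sum (eq_bigr _ (fun t _ => lfZ t)).
have [us_u|us_u] := boolP (u \in s).
  rewrite (bigD1_seq u) //= big1 ?addr0 => [|t tu]; first by rewrite eqxx mulr1.
  by rewrite eq_sym (negbTE tu) mulr0.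
rewrite big_seq big1 => [|t ts].
  by apply/esym/eqP; apply: contraNT us_u => /sf.
case: eqP => [ut|]; last by rewrite mulr0.
by rewrite ut ts in us_u.
Qed.
End FreeModuleBasis.

Section PathAlgebra.
Variables (R : comNzRingType) (Q : quiver).
Local Notation RQ := (path_ring R Q).

Definition trivial_path (i : vertex Q) : qpath Q := Sub (i, [::]) isT.

Lemma arrow_path_subproof (a : arrow Q) :
  is_path (Defs.tail a, [:: a]).1 (Defs.tail a, [:: a]).2.
Proof. by rewrite /= eqxx. Qed.

Definition arrow_path (a : arrow Q) : qpath Q :=
  Sub (Defs.tail a, [:: a]) (arrow_path_subproof a).

Definition vertex_elem (i : vertex Q) : RQ := path_elem R (trivial_path i).
Definition arrow_elem (a : arrow Q) : RQ := path_elem R (arrow_path a).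

Lemma path_elem_free (p : qpath Q) : path_elem R p = free_elem R p.
Proof. exact: free_moduleP. Qed.

Lemma path_ring_ind (P : RQ -> Prop) :
    P 0 -> (forall r f g, P f -> P g -> P (r *: f + g)) ->
    (forall p, P (path_elem R p)) -> forall f, P f.
Proof.
move=> P0 PD Pp f; rewrite -[f]free_lift_id.
have [s us sf] := free_support f; rewrite (free_liftE _ us sf).
elim: s {us sf} => [|p s IH]; first by rewrite big_nil.
rewrite big_cons; apply: PD; last exact: IH.
by rewrite -path_elem_free.
Qed.

Lemma path_elem_comp (p q w : qpath Q) :
  endpoint (source q) (arrows q) = source p ->
  source w = source q -> arrows w = arrows q ++ arrows p ->
  path_elem R p * path_elem R q = path_elem R w.
Proof.
move=> qp ws wa; apply: path_ringP => v; rewrite path_elem_mul qp eqxx /=.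
rewrite -ws -wa -surjective_pairing.
by rewrite -val_eqE.
Qed.

Lemma path_elem_comp0 (p q : qpath Q) :
  endpoint (source q) (arrows q) != source p -> path_elem R p * path_elem R q = 0.
Proof.
by move=> qp; apply: path_ringP => v; rewrite path_elem_mul (negbTE qp).
Qed.

Lemma vertex_elemK i : vertex_elem i * vertex_elem i = vertex_elem i.
Proof. exact: path_elem_comp. Qed.

Lemma vertex_elem_orth i j : i != j -> vertex_elem i * vertex_elem j = 0.
Proof. by move=> ij; apply: path_elem_comp0; rewrite eq_sym. Qed.

Lemma head_arrow_elem a : vertex_elem (Defs.head a) * arrow_elem a = arrow_elem a.
Proof. exact: path_elem_comp. Qed.

Lemma arrow_elem_tail a : arrow_elem a * vertex_elem (Defs.tail a) = arrow_elem a.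
Proof. exact: path_elem_comp. Qed.

Lemma sum_vertex_elem : \sum_i vertex_elem i = 1.
Proof.
apply: path_ringP => p.
have lf : linear (fun f : RQ => path_ring_coef f p : R^o) by [].
rewrite -[LHS]/(to_linear lf _) linear_sum (bigD1 (source p)) //= big1 ?addr0 => [|i ip].
  rewrite [RHS]path_oneE /path_length size_eq0; congr (_%:R); congr nat_of_bool.
  apply/eqP/eqP => [->//|pa]; exact: path_eq.
rewrite [LHS]/= [X in (nat_of_bool X)%:R](_ : _ = false) //; apply/eqP => pE.
by rewrite pE eqxx in ip.
Qed.

(** Induction on the last arrow of a path: the arrow traversed last is the leftmost factor of the
    product. *)
Lemma path_ring_gen (P : RQ -> Prop) :
    (forall r, P (path_scalar Q r)) -> (forall f g, P f -> P g -> P (f + g)) ->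
    (forall f g, P f -> P g -> P (f * g)) ->
    (forall i, P (vertex_elem i)) -> (forall a, P (arrow_elem a)) -> forall f, P f.
Proof.
move=> Pr PD PM Pi Pa; apply: path_ring_ind => [|r f g Pf Pg|p].
- by have := Pr 0; rewrite /path_scalar scale0r.
- by apply: PD => //; rewrite -[f]mul1r path_scaleAl; apply: PM => //; exact: Pr.
case: p => -[i s]; elim/last_ind: s => [|s a IH] ip.
  by rewrite (_ : path_elem R _ = vertex_elem i) //; congr path_elem; apply: val_inj.
have [is_s sa] : is_path i s /\ Defs.tail a = endpoint i s.
  by move: ip; rewrite /= -cats1 is_path_cat /= andbT => /andP[? /eqP].
have <- : arrow_elem a * path_elem R (Sub (i, s) is_s) =
    path_elem R (exist _ (i, rcons s a) ip).
  by apply: path_elem_comp; rewrite // /arrows /= cats1.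
exact/PM/IH.
Qed.

Lemma path_algebra_linear (U V : lmodType (path_algebra R Q)) (g : U -> V) :
    linear (g : restrict U -> restrict V) ->
    (forall i u, g (vertex_elem i *: u) = vertex_elem i *: g u) ->
    (forall a u, g (arrow_elem a *: u) = arrow_elem a *: g u) ->
  linear g.
Proof.
move=> lg gi ga.
pose g' : {linear restrict U -> restrict V} := to_linear lg.
have gD u v : g (u + v) = g u + g v := linearD g' u v.
suff gZ f u : g (f *: u) = f *: g u by move=> f u v; rewrite gD gZ.
move: f u; apply: path_ring_gen => [r u|f f' gf gf' u|f f' gf gf' u|//|//].
- exact: (linearZ_LR g' r u).
- by rewrite !scalerDl gD gf gf'.
- by rewrite -!scalerA gf gf'.
Qed.
End PathAlgebra.

(** * From quiver representations to modules over the path algebra *)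

Section RepresentationModule.
Variables (R : comNzRingType) (Q : quiver) (M : lmodType R).
Variables (ev : vertex Q -> {linear M -> M}) (av : arrow Q -> {linear M -> M}).
Local Notation RQ := (path_ring R Q).

(** A representation is encoded as the single module [M], the direct sum of the vertex modules, with
    the projections [ev] and with the arrow maps extended by zero. *)
Definition quiver_rep : Prop :=
  [/\ forall i j m, ev i (ev j m) = if i == j then ev j m else 0,
      forall m, \sum_i ev i m = m,
      forall a m, ev (Defs.head a) (av a m) = av a m &
      forall a m, av a (ev (Defs.tail a) m) = av a m].

Hypothesis rep : quiver_rep.

Definition rep_module of quiver_rep : Type := M.
Local Notation Z := (rep_module rep).
HB.instance Definition _ := GRing.Zmodule.on Z.

Definition path_act (p : qpath Q) (m : M) : M :=
  foldl (fun m a => av a m) (ev (source p) m) (arrows p).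

Lemma path_act_linear p : linear (path_act p).
Proof.
move=> r m m'; rewrite /path_act linearP.
by elim: (arrows p) (ev _ m) (ev _ m') => //= a s IH u v; rewrite linearP IH.
Qed.

(** Only the final map matters: for a nonempty path the last arrow lands in the summand of its head,
    and the trivial path is a projection. *)
Lemma ev_foldl j i s m : is_path i s ->
  ev j (foldl (fun m a => av a m) (ev i m) s) =
  if j == endpoint i s then foldl (fun m a => av a m) (ev i m) s else 0.
Proof.
case: rep => evK _ hv _; elim/last_ind: s => [|s a _]; first by rewrite /= evK.
rewrite foldl_rcons -cats1 endpoint_cat => _.
by rewrite -[in LHS]hv evK hv.
Qed.

Definition rep_act (f : RQ) (m : M) : M := free_lift (fun p => path_act p m : M) f.

Lemma rep_act_elem p m : rep_act (path_elem R p) m = path_act p m.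
Proof. by rewrite /rep_act path_elem_free free_lift_elem. Qed.

Lemma rep_actDl m : {morph rep_act^~ m : f g / f + g}.
Proof. by move=> f g; exact: linearD. Qed.

Lemma rep_actZl r f m : rep_act (r *: f) m = r *: rep_act f m.
Proof. exact: linearZ. Qed.

Lemma rep_act_linear f : linear (rep_act f).
Proof.
move=> r m m'; have scl : linear (fun x : M => r *: x).
  by move=> s x y; rewrite scalerDr !scalerA mulrC.
rewrite /rep_act -[r *: free_lift _ f]/(to_linear scl _) linear_free_lift -free_liftD.
by congr free_lift; apply/funext => p; exact: path_act_linear.
Qed.

Lemma rep_actDr : right_distributive rep_act +%R.
Proof. by move=> f m m'; have := rep_act_linear f 1 m m'; rewrite !scale1r. Qed.

Lemma rep_act0 f : rep_act f 0 = 0.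
Proof. exact: (linear0 (to_linear (rep_act_linear f))). Qed.

Lemma rep_act0l m : rep_act 0 m = 0.
Proof. exact: linear0. Qed.

Lemma rep_act_path p q m :
  rep_act (path_elem R p) (rep_act (path_elem R q) m) =
  rep_act (path_elem R p * path_elem R q) m.
Proof.
rewrite !rep_act_elem {1}/path_act {1}/path_act ev_foldl; last exact: (valP q).
have [e|ne] := eqVneq (source p) (endpoint (source q) (arrows q)).
  have w_path : is_path (source q) (arrows q ++ arrows p).
    by rewrite is_path_cat -e (valP q); exact: (valP p).
  rewrite (@path_elem_comp _ _ p q (Sub (source q, _) w_path)) // rep_act_elem.
  by rewrite /path_act foldl_cat.
rewrite path_elem_comp0 1?eq_sym // rep_act0l.
by elim: (arrows p) => //= a s IH; rewrite linear0.
Qed.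

Lemma rep_actA f g m : rep_act f (rep_act g m) = rep_act (f * g) m.
Proof.
elim/path_ring_ind: f => [|r f f' If If'|p]; first by rewrite mul0r !rep_act0l.
  by rewrite mulrDl -path_scaleAl !rep_actDl !rep_actZl If If'.
elim/path_ring_ind: g => [|r g g' Ig Ig'|q]; last exact: rep_act_path.
  by rewrite mulr0 !rep_act0l rep_act0.
rewrite mulrDr -path_scaleAr !rep_actDl !rep_actZl -Ig -Ig'.
exact: rep_act_linear.
Qed.

Lemma rep_act1 : left_id 1 rep_act.
Proof.
move=> m; have [_ sum1 _ _] := rep; rewrite -[RHS]sum1 -(sum_vertex_elem R Q).
pose g : {linear RQ -> M} := free_lift (fun p => path_act p m : M).
rewrite -[LHS]/(g _) linear_sum; apply: eq_bigr => i _.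
exact: rep_act_elem.
Qed.

HB.instance Definition _ := GRing.Zmodule_isLmodule.Build (path_ring R Q) Z
  rep_actA rep_act1 rep_actDr rep_actDl.

Definition rep_lmod : lmodType (path_algebra R Q) := rep_module rep.

Lemma rep_lmod_scalar r (z : rep_lmod) : path_scalar Q r *: z = r *: (z : M) :> M.
Proof.
rewrite -[LHS]/(rep_act (r *: (1 : RQ)) z) rep_actZl; congr (_ *: _); exact: rep_act1.
Qed.
End RepresentationModule.

(** * Extensions and arrow cocycles *)

Section FreeResolution.
Variables (A : pzRingType) (X : lmodType A).

Lemma kernel_valP (V W : lmodType A) (f : {linear V -> W}) (z : kernel f) : f (val z) = 0.
Proof. exact/eqP/(valP z). Qed.

Lemma differential_kernel n z :
  free_lift (@id (syzygy X n)) (differential X n z) = 0.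
Proof. exact: kernel_valP. Qed.

(** The next term of the resolution is free on the elements of the kernel, so the basis vector
    indexed by [w] is a preimage. *)
Lemma kernel_differential n (w : resolution X n) :
  free_lift (@id (syzygy X n)) w = 0 -> exists z, differential X n z = w.
Proof.
move=> /eqP w0; exists (free_elem A (Kernel w0 : syzygy X n.+1)).
by rewrite /differential free_lift_elem.
Qed.

Lemma differentialK n z : differential X n (differential X n.+1 z) = 0.
Proof. by rewrite {1}/differential differential_kernel. Qed.

Lemma differential_exact n z :
  differential X n z = 0 -> exists z', differential X n.+1 z' = z.
Proof. by move=> z0; apply: kernel_differential; apply: val_inj. Qed.
End FreeResolution.

Section Restriction.
Variables (R : pzRingType) (A : algebra R) (X Y : lmodType A).

Lemma restrict_linear (f : {linear X -> Y}) : linear (f : restrict X -> restrict Y).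
Proof. by move=> r x y; exact: (linearP f). Qed.

Lemma action_linear (a : A) : linear ((fun x => a *: x) : restrict X -> restrict X).
Proof.
move=> r x y; rewrite scalerDr; congr (_ + _).
change (a *: (scalar_map A r *: (x : X)) = scalar_map A r *: (a *: (x : X))).
by rewrite !scalerA scalar_map_central.
Qed.
End Restriction.

Section TwistedSum.
Variables (R : comNzRingType) (Q : quiver) (X Y : lmodType (path_algebra R Q)).
Local Notation e_ i := (vertex_elem R i).
Local Notation a_ a := (arrow_elem R a).

Implicit Type eta : arrow Q -> {linear restrict X -> restrict Y}.

Definition act (V : lmodType (path_algebra R Q)) (f : path_algebra R Q) :
  {linear restrict V -> restrict V} := to_linear (action_linear f).

(** Cuts an arbitrary [R]-linear map down to its component from X_t(a) to Y_h(a). *)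
Definition corner eta (a : arrow Q) : {linear restrict X -> restrict Y} :=
  act Y (e_ (Defs.head a)) \o eta a \o act X (e_ (Defs.tail a)).

Definition sum_vertex (i : vertex Q) (z : restrict Y * restrict X) :
  restrict Y * restrict X := (e_ i *: (z.1 : Y), e_ i *: (z.2 : X)).

(** The block triangular arrow action on the middle term of the extension of [X] by [Y] given by
    [eta]. *)
Definition sum_arrow eta (a : arrow Q) (z : restrict Y * restrict X) :
    restrict Y * restrict X :=
  (a_ a *: (z.1 : Y) + corner eta a z.2, a_ a *: (z.2 : X)).

Lemma sum_vertex_linear i : linear (sum_vertex i).
Proof.
by move=> r u v; congr (_, _); [exact: (linearP (act Y _))|exact: (linearP (act X _))].
Qed.

Lemma sum_arrow_linear eta a : linear (sum_arrow eta a).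
Proof.
move=> r u v; congr (_, _); last exact: (linearP (act X _)).
change (act Y (a_ a) (r *: u.1 + v.1) + corner eta a (r *: u.2 + v.2) =
  r *: (act Y (a_ a) u.1 + corner eta a u.2) + (act Y (a_ a) v.1 + corner eta a v.2)).
by rewrite !linearP scalerDr addrACA.
Qed.

Lemma sum_quiver_rep eta :
  quiver_rep (fun i => to_linear (sum_vertex_linear i))
             (fun a => to_linear (sum_arrow_linear eta a)).
Proof.
split=> /= [i j z|z|a z|a z].
- rewrite /sum_vertex /= !scalerA; case: eqP => [->|/eqP ij].
    by rewrite vertex_elemK.
  by rewrite vertex_elem_orth // !scale0r.
- have sumE (V : lmodType (path_algebra R Q)) (v : V) : \sum_i e_ i *: v = v.
    by rewrite -scaler_suml (sum_vertex_elem R Q) scale1r.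
  transitivity ((\sum_i e_ i *: (z.1 : Y), \sum_i e_ i *: (z.2 : X)) :
      restrict Y * restrict X).
    by elim/big_rec3: _ => // i x y w _ ->.
  by rewrite !sumE -surjective_pairing.
- rewrite /sum_vertex /= scalerDr !scalerA head_arrow_elem.
  by rewrite vertex_elemK.
- rewrite /sum_arrow /= !scalerA arrow_elem_tail.
  by rewrite vertex_elemK.
Qed.

Definition twisted_sum eta : lmodType (path_algebra R Q) := rep_lmod (sum_quiver_rep eta).

Local Notation P0 := (resolution X 0).
Local Notation d := (free_lift (@id X)).

(* A cochain [t] on [P0] represents the class of [eta] when [w |-> (t w, d w)] is
   a homomorphism from [P0] to the extension of [X] by [Y] defined by [eta]. *)
Definition twisted eta (t : P0 -> Y) : Prop :=
  [/\ linear (t : restrict P0 -> restrict Y),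
      forall i w, t (e_ i *: w) = e_ i *: t w &
      forall a w, t (a_ a *: w) = a_ a *: t w + corner eta a (d w)].

(** [P0] is free on the elements of [X], so [x |-> (0, x)] extends to a homomorphism into the
    twisted sum. Its second component is [d]; its first component is the cochain. *)
Lemma exists_twisted eta : exists t, twisted eta t.
Proof.
pose h (x : X) : twisted_sum eta := (0, x).
pose l : {linear P0 -> twisted_sum eta} := free_lift h.
have vertexE i (z : twisted_sum eta) : e_ i *: z = sum_vertex i z.
  exact: rep_act_elem.
have arrowE a (z : twisted_sum eta) : a_ a *: z = sum_arrow eta a z.
  have [_ _ _ aE] := sum_quiver_rep eta.
  by rewrite -[LHS]/(rep_act _ _ _ _) rep_act_elem; exact: aE.
have scalarE r (z : twisted_sum eta) :
    path_scalar Q r *: z = r *: (z : restrict Y * restrict X) :> _ * _.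
  exact: rep_lmod_scalar.
have sndE (w : P0) : (l w).2 = d w.
  have lsnd : linear (snd : twisted_sum eta -> X).
    apply: path_algebra_linear => [r u v|i u|a u].
    - by rewrite -[r *: u]/(path_scalar Q r *: (u : twisted_sum eta)) scalarE.
    - by rewrite vertexE.
    - by rewrite arrowE.
  exact: (linear_free_lift (to_linear lsnd)).
exists (fun w => (l w).1); split=> [r v w|i w|a w].
- have -> : l (r *: (v : restrict P0) + w) = path_scalar Q r *: l v + l w.
    exact: linearP.
  by rewrite scalarE.
- by rewrite linearZ_LR vertexE.
- by rewrite linearZ_LR arrowE /sum_arrow /= sndE.
Qed.
End TwistedSum.

(** * Representing cocycles of Ext^1 classes *)

Section ExtCocycles.
Variables (R : pzRingType) (A : algebra R) (X Y : lmodType A).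

(** A relation between classes and plain functions, so that later arguments avoid the kernel and
    quotient structures behind [Ext1]. *)
Definition ext_cocycle (u : Ext1 X Y) (f : resolution X 1 -> Y) : Prop :=
  exists2 z : kernel (precomp (Y := Y) (differential X 1)),
    u = quotient_proj (boundary_closed _ _) z & forall v, val z v = f v.

Lemma ext_cocycle_linear u f : ext_cocycle u f -> linear f.
Proof. by move=> [z _ zf] a v w; rewrite -!zf linearP. Qed.

Lemma ext_cocycle_closed u f v : ext_cocycle u f -> f (differential X 1 v) = 0.
Proof.
move=> [z _ zf]; rewrite -zf.
exact: (congr1 (fun h : module_hom _ Y => h v) (kernel_valP z)).
Qed.

Lemma ext_cocycle_exists u : exists f, ext_cocycle u f.
Proof. by have [z <-] := quotient_proj_surj u; exists (val z); exists z. Qed.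

Lemma ext_class_exists (f : resolution X 1 -> Y) :
  linear f -> (forall v, f (differential X 1 v) = 0) -> exists u, ext_cocycle u f.
Proof.
move=> lf f0.
have fP : (f : _ -> restrict Y) \in @hom_pred _ _ (resolution X 1) Y.
  exact/asboolP.
have zP : ModuleHom fP \in kernel_pred (precomp (Y := Y) (differential X 1)).
  by rewrite unfold_in; apply/eqP/homP => v; exact: f0.
by exists (quotient_proj (boundary_closed _ _) (Kernel zP)); exists (Kernel zP).
Qed.

Lemma ext_cocycleP u u' f f' : ext_cocycle u f -> ext_cocycle u' f' ->
  u = u' <-> exists g : {linear resolution X 0 -> Y},
    forall v, f v - f' v = g (differential X 0 v).
Proof.
move=> [z -> zf] [z' -> zf']; rewrite quotient_projP; split.
  move=> /asboolP[g gE]; exists g => v.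
  by rewrite -zf -zf'; exact: (congr1 (fun h : module_hom _ Y => h v) (esym gE)).
move=> [g gE]; apply/asboolP.
have gP : (g : _ -> restrict Y) \in @hom_pred _ _ (resolution X 0) Y.
  by apply/asboolP => a v w; rewrite linearP.
exists (ModuleHom gP); apply: homP => v.
by rewrite -[LHS]/(g (differential X 0 v)) -gE -zf -zf'.
Qed.

Lemma ext_cocycleD r u u' f f' : ext_cocycle u f -> ext_cocycle u' f' ->
  ext_cocycle (r *: u + u') (fun v => scalar_map A r *: f v + f' v).
Proof.
move=> [z -> zf] [z' -> zf']; exists (r *: z + z').
  by rewrite quotient_projD [in RHS]quotient_projZ.
by move=> v; rewrite -zf -zf'.
Qed.
End ExtCocycles.

Section ArrowCocycles.
Variables (R : comNzRingType) (Q : quiver) (X Y : lmodType (path_algebra R Q)).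
Local Notation e_ i := (vertex_elem R i).
Local Notation a_ a := (arrow_elem R a).
Local Notation P0 := (resolution X 0).
Local Notation d := (free_lift (@id X)).
Local Notation d0 := (differential X 0).
Implicit Type eta : arrow Q -> {linear restrict X -> restrict Y}.

(** The graph of the map from prod_a Hom_R(X_t(a), Y_h(a)) to Ext^1. The lemmas below make it total,
    single-valued, linear, with the image of the differential as kernel, and onto when [restrict X]
    is projective. *)
Definition ext_arrow eta (u : Ext1 X Y) : Prop :=
  exists2 t, twisted eta t & ext_cocycle u (fun v => t (d0 v)).

Lemma d_d0 (v : resolution X 1) : d (d0 v) = 0.
Proof. exact: (@differential_kernel _ X 0). Qed.

Lemma twistedD r eta eta' eta'' t t' : twisted eta t -> twisted eta' t' ->
  (forall a x, corner eta'' a x = r *: corner eta a x + corner eta' a x) ->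
  twisted eta'' (fun w => path_scalar Q r *: t w + t' w).
Proof.
move=> [lt te ta] [lt' te' ta'] etaE.
pose T := (act Y (path_scalar Q r) \o to_linear lt) \+ to_linear lt'.
split=> [s v w|i w|a w].
- exact: (linearP (T : {linear _ -> _})).
- by rewrite te te' scalerDr !scalerA path_scalar_central.
- rewrite ta ta' etaE !scalerDr !scalerA path_scalar_central addrACA.
  by rewrite -(scalerA (path_scalar Q r)).
Qed.

(** The inhomogeneous terms of the two cochains depend only on [eta] and [d], so they cancel. *)
Lemma twisted_sub eta t t' : twisted eta t -> twisted eta t' ->
  linear (fun w => t w - t' w).
Proof.
move=> [lt te ta] [lt' te' ta']; apply: path_algebra_linear => [r v w|i w|a w].
- exact: (linearP (to_linear lt \- to_linear lt')).
- by rewrite te te' scalerBr.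
- by rewrite ta ta' opprD addrACA subrr addr0 scalerBr.
Qed.

(** [d] vanishes on the image of [d0], hence so does the twisting term, and [t \o d0] is a genuine
    cocycle. *)
Lemma ext_arrow_exists eta : exists u, ext_arrow eta u.
Proof.
have [t tw] := exists_twisted eta; have [lt te ta] := tw.
have [|v|u uP] := @ext_class_exists _ (path_algebra R Q) X Y (fun v => t (d0 v)).
- apply: path_algebra_linear => [r v w|i w|a w].
  + exact: (linearP (to_linear lt \o to_linear (restrict_linear d0))).
  + by rewrite linearZ_LR te.
  + by rewrite linearZ_LR ta d_d0 linear0 addr0.
- by rewrite differentialK; exact: (linear0 (to_linear lt)).
by exists u; exists t.
Qed.

Lemma ext_arrow_inj eta u u' : ext_arrow eta u -> ext_arrow eta u' -> u = u'.
Proof.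
move=> [t tw tu] [t' tw' tu']; apply/(ext_cocycleP tu tu').
by exists (to_linear (twisted_sub tw tw')).
Qed.

Lemma ext_arrow_corner eta eta' u :
  (forall a x, corner eta' a x = corner eta a x) -> ext_arrow eta u -> ext_arrow eta' u.
Proof.
move=> etaE [t [lt te ta] tu]; exists t => //.
by split=> // a w; rewrite ta etaE.
Qed.

Lemma ext_arrowD r eta eta' eta'' u u' : ext_arrow eta u -> ext_arrow eta' u' ->
  (forall a x, corner eta'' a x = r *: corner eta a x + corner eta' a x) ->
  ext_arrow eta'' (r *: u + u').
Proof.
move=> [t tw tu] [t' tw' tu'] etaE.
exists (fun w => path_scalar Q r *: t w + t' w); first exact: twistedD etaE.
exact: (ext_cocycleD r tu tu').
Qed.

(** If [g] cobounds the cocycle, then [t - g] kills the kernel of [d] and descends to [G] on [X];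
    the twisted equation for [t] becomes the formula for [eta]. Conversely [G \o d] is itself a
    twisted cochain, and its difference with [t] is the required homomorphism. *)
Lemma ext_arrow0 eta u : ext_arrow eta u ->
  u = 0 <-> exists2 G : {linear restrict X -> restrict Y},
    forall i x, G (e_ i *: (x : X)) = e_ i *: (G x : Y) &
    forall a x, corner eta a x = G (a_ a *: (x : X)) - a_ a *: (G x : Y) :> Y.
Proof.
move=> [t [lt te ta] tu].
have z0 : ext_cocycle (0 : Ext1 X Y) (fun _ => 0).
  by exists 0 => //; apply/esym; exact: (@raddf0).
rewrite (ext_cocycleP tu z0); split.
  move=> [g gE]; pose h (w : P0) : Y := t w - g w.
  pose hR : {linear restrict P0 -> restrict Y} :=
    to_linear lt \- to_linear (restrict_linear g).
  have h_ker w w' : d w = d w' -> h w = h w'.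
    move=> dw; apply/eqP; rewrite -subr_eq0 -(linearB hR); apply/eqP.
    have [|v <-] := @kernel_differential _ X 0 (w - w').
      by apply: (etrans (linearB d w w')); rewrite /= dw subrr.
    by rewrite /hR /= -gE subr0 subrr.
  have lG : linear ((fun x => h (free_elem _ x)) : restrict X -> restrict Y).
    move=> r x y.
    rewrite -[RHS](linearP hR); apply: h_ker.
    rewrite free_lift_elem -[RHS]/(to_linear (restrict_linear d) _).
    by rewrite linearP /= !free_lift_elem.
  exists (to_linear lG) => [i x|a x] /=.
    rewrite -(h_ker (e_ i *: free_elem _ x)); last first.
      by rewrite linearZ_LR /= !free_lift_elem.
    by rewrite /h te linearZ scalerBr.
  rewrite -(h_ker (a_ a *: free_elem _ x)); last first.
    by rewrite linearZ_LR /= !free_lift_elem.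
  by rewrite /h ta linearZ scalerBr free_lift_elem [X in X - _]addrAC [RHS]addrC addKr.
move=> [G Ge Ga].
have tG : twisted eta (fun w => G (d w)).
  split=> [r v w|i w|a w].
  - exact: (linearP (G \o to_linear (restrict_linear d))).
  - by rewrite linearZ_LR Ge.
  - by rewrite linearZ_LR Ga addrC subrK.
exists (to_linear (twisted_sub (And3 lt te ta) tG)) => v.
by rewrite /= d_d0 (linear0 G).
Qed.

Hypothesis X_projective : projective (restrict X).

(** Any [R]-linear section [s0] becomes compatible with the vertices after replacing it by the sum
    of the [e_i s0 e_i]. *)
Lemma equivariant_section : exists s : {linear restrict X -> restrict P0},
  (forall x, d (s x) = x) /\ forall i x, s (e_ i *: (x : X)) = e_ i *: (s x : P0).
Proof.
have [|s0 s0P] := @X_projective _ _ (to_linear (restrict_linear d)) idfun.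
  by move=> x; exists (free_elem _ (x : X)); rewrite /= free_lift_elem.
pose s (x : restrict X) : restrict P0 :=
  \sum_i act P0 (e_ i) (s0 (act X (e_ i) x)).
have ls : linear s.
  move=> r x y; rewrite /s scaler_sumr -big_split; apply: eq_bigr => i _.
  by rewrite !linearP.
exists (to_linear ls); split=> [x|i x].
  rewrite /= /s (linear_sum d).
  rewrite -[RHS](scale1r (x : X)) -(sum_vertex_elem R Q) scaler_suml.
  by apply: eq_bigr => i _; rewrite linearZ /= [d _]s0P /= scalerA vertex_elemK.
rewrite /= /s scaler_sumr; apply: eq_bigr => j _ /=; rewrite !scalerA.
have [->|ij] := eqVneq j i; first by rewrite !vertex_elemK.
have ji : i != j by rewrite eq_sym.
rewrite (vertex_elem_orth R ij) (vertex_elem_orth R ji).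
by rewrite [X in s0 X]scale0r [RHS]scale0r (linear0 s0) scaler0.
Qed.

(* The cocycle is a homomorphism [phi] on the first syzygy; an [R]-linear section [s]
   of [d] makes [w |-> phi (w - s (d w))] a twisted cochain inducing it. *)
Lemma ext_arrow_surj u : exists eta, ext_arrow eta u.
Proof.
have [f uf] := ext_cocycle_exists u; have lf := ext_cocycle_linear uf.
have [s [ds se]] := equivariant_section.
have [phi phiE] : exists phi : P0 -> Y, forall v, phi (d0 v) = f v.
  (* [phi] is [f] transported along [d0]. It is single-valued because [f] kills the kernel of [d0],
     by exactness; outside the image of [d0] it takes the default value 0. *)
  have [|phi phiP] := @choice P0 Y (fun w y => forall v, d0 v = w -> f v = y).
    move=> w; have [[v <-]|none] := pselect (exists v, d0 v = w); last first.
      by exists 0 => v vw; case: none; exists v.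
    exists (f v) => v' vv'; apply/eqP; rewrite -subr_eq0 -(linearB (to_linear lf)).
    have [|z <-] := @differential_exact _ X 0 (v' - v).
      by apply: (etrans (linearB d0 v' v)); rewrite /= vv' subrr.
    by rewrite /= (ext_cocycle_closed z uf).
  by exists phi => v; rewrite (phiP (d0 v) v).
have phi_lin (a : path_algebra R Q) w w' : d w = 0 -> d w' = 0 ->
    phi (a *: w + w') = a *: phi w + phi w'.
  move=> /(@kernel_differential _ X 0)[v <-] /(@kernel_differential _ X 0)[v' <-].
  by rewrite -(linearP d0) !phiE; exact: lf.
have phi0 : phi 0 = 0.
  by rewrite -(linear0 d0) phiE; exact: (linear0 (to_linear lf)).
have phiZ (a : path_algebra R Q) w : d w = 0 -> phi (a *: w) = a *: phi w.
  by move=> dw; have := phi_lin a w 0 dw (linear0 _); rewrite phi0 !addr0.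
(* [b a] is the failure of [s] to commute with the arrow. It lands in the kernel of [d], so [phi]
   can be applied, and this gives the component of [eta] at [a]. *)
pose b a : {linear restrict X -> restrict P0} :=
  (act P0 (a_ a) \o s) \- (s \o act X (a_ a)).
have db a (x : X) : d (b a x) = 0.
  by apply: (etrans (linearB d _ _)); rewrite /= ds linearZ_LR /= ds subrr.
have lc a : linear ((fun x => phi (b a x)) : restrict X -> restrict Y).
  by move=> r x y; rewrite linearP; exact: phi_lin.
exists (fun a => to_linear (lc a)).
pose p : {linear restrict P0 -> restrict P0} :=
  idfun \- (s \o to_linear (restrict_linear d)).
have dp (w : P0) : d (p w) = 0.
  by apply: (etrans (linearB d _ _)); rewrite /= ds subrr.
exists (fun w => phi (p w)).
  split=> [r v w|i w|a w].
  - by rewrite linearP; exact: phi_lin.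
  - rewrite -phiZ //; congr phi.
    by rewrite /p /= linearZ_LR /= se scalerBr.
  - have -> : corner (fun a => to_linear (lc a)) a (d w) = phi (b a (d w)).
      rewrite /= -phiZ; last exact: db.
      congr phi; rewrite scalerBr !scalerA -se !scalerA.
      by rewrite arrow_elem_tail head_arrow_elem se scalerA arrow_elem_tail.
    rewrite -phi_lin //; congr phi.
    rewrite /p /b /= linearZ_LR /= scalerBr addrA subrK.
    by [].
have -> : (fun v => phi (d0 v - s (d (d0 v)))) = f; last exact: uf.
by apply/funext => v; rewrite d_d0 (linear0 s) subr0 phiE.
Qed.
End ArrowCocycles.

(** * Coordinates *)

Section Retracts.
Variables (R : comNzRingType) (M : lmodType R).

Lemma fg_projective_coordinates : fg_projective M ->
  exists n (p : {linear M -> 'rV[R]_n}) (q : {linear 'rV[R]_n -> M}), cancel p q.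
Proof.
move=> [[s sP] projM].
pose q (u : 'rV[R]_(size s)) : M := \sum_(i < size s) u 0 i *: s`_i.
have lq : linear q.
  move=> a u v; rewrite /q scaler_sumr -big_split; apply: eq_bigr => i _.
  by rewrite !mxE scalerDl scalerA.
have [x|p pP] := @projM _ _ (to_linear lq) idfun.
  have [c ->] := sP x; exists (\row_i c i).
  by apply: eq_bigr => i _; rewrite mxE.
by exists (size s), p, (to_linear lq).
Qed.

Lemma fg_projective_retract (V : vectType R) (i : {linear M -> V}) (r : {linear V -> M}) :
  cancel i r -> fg_projective M.
Proof.
move=> ir; pose b (j : 'I_(dim V)) : M := r (r2v (delta_mx 0 j : 'rV_(dim V))).
have bE (v : V) : r v = \sum_j (v2r v) 0 j *: b j.
  rewrite -[v in LHS]v2rK [v2r v in LHS]row_sum_delta !linear_sum.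
  by apply: eq_bigr => j _; rewrite !linearZ.
split.
  exists [seq b j | j <- enum 'I_(dim V)] => x.
  have sz : size [seq b j | j <- enum 'I_(dim V)] = dim V.
    by rewrite size_map size_enum_ord.
  exists (fun j => v2r (i x) 0 (cast_ord sz j)); rewrite -{1}[x]ir bE.
  rewrite (reindex (cast_ord sz)) /=; last first.
    by exists (cast_ord (esym sz)) => j _; rewrite ?cast_ordK ?cast_ordKV.
  apply: eq_bigr => j _; congr (_ *: _).
  have jV : (j < dim V)%N := ltn_ord (cast_ord sz j).
  rewrite (nth_map (cast_ord sz j)) ?size_enum_ord //.
  by congr b; apply: val_inj; rewrite /= nth_enum_ord.
move=> U W g f g_surj.
have [v|s sP] := @linear_section R U W V g (f \o r); first exact: g_surj.
by exists (s \o i) => x; rewrite /= sP /= ir.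
Qed.
End Retracts.

Section Coordinates.
Variables (R : comNzRingType) (Q : quiver).
Local Notation e_ i := (vertex_elem R i).
Local Notation a_ a := (arrow_elem R a).

Section LinearMatrix.
Variables (U V : lmodType R) (l m : nat).
Variables (pU : {linear U -> 'rV[R]_l}) (qU : {linear 'rV[R]_l -> U}).
Variables (pV : {linear V -> 'rV[R]_m}) (qV : {linear 'rV[R]_m -> V}).
Hypotheses (pUK : cancel pU qU) (pVK : cancel pV qV).

Definition coord_mx (f : {linear U -> V}) : 'M[R]_(l, m) := lin1_mx (pV \o f \o qU).

Lemma mul_coord_mx (f : {linear U -> V}) u : u *m coord_mx f = pV (f (qU u)).
Proof. by rewrite mul_rV_lin1. Qed.

Lemma coord_mxK (f : {linear U -> V}) x : qV (pU x *m coord_mx f) = f x.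
Proof. by rewrite mul_coord_mx pUK pVK. Qed.

Lemma mx_linear (N : 'M[R]_(l, m)) : linear (fun x => qV (pU x *m N)).
Proof. by move=> a x y; rewrite linearP mulmxDl -scalemxAl linearP. Qed.

Lemma coord_mx_is_linear a (f g h : {linear U -> V}) :
  (forall x, h x = a *: f x + g x) -> coord_mx h = a *: coord_mx f + coord_mx g.
Proof.
move=> hE; apply/row_matrixP => i; rewrite !rowE mulmxDr -scalemxAr.
by rewrite !mul_coord_mx hE linearP.
Qed.
End LinearMatrix.

Lemma coord_mx_comp (U V W : lmodType R) l m n
    (pU : {linear U -> 'rV[R]_l}) (qU : {linear 'rV[R]_l -> U})
    (pV : {linear V -> 'rV[R]_m}) (qV : {linear 'rV[R]_m -> V})
    (pW : {linear W -> 'rV[R]_n}) (qW : {linear 'rV[R]_n -> W})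
    (f : {linear U -> V}) (g : {linear V -> W}) (h : {linear U -> W}) :
  cancel pV qV -> (forall x, h x = g (f x)) ->
  coord_mx qU pV f *m coord_mx qV pW g = coord_mx qU pW h.
Proof.
move=> pVK hE; apply/row_matrixP => i.
by rewrite !rowE mulmxA !mul_coord_mx pVK hE.
Qed.

Variables (X Y : lmodType (path_algebra R Q)) (n m : nat).
Variables (pX : {linear restrict X -> 'rV[R]_n}) (qX : {linear 'rV[R]_n -> restrict X}).
Variables (pY : {linear restrict Y -> 'rV[R]_m}) (qY : {linear 'rV[R]_m -> restrict Y}).
Hypotheses (pXK : cancel pX qX) (pYK : cancel pY qY).

Local Notation EX i := (coord_mx qX pX (act X (e_ i))).
Local Notation AX a := (coord_mx qX pX (act X (a_ a))).
Local Notation EY i := (coord_mx qY pY (act Y (e_ i))).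
Local Notation AY a := (coord_mx qY pY (act Y (a_ a))).

Lemma coord_matrix_rep :
  matrix_rep (@Defs.head Q) (@Defs.tail Q) (fun i => EX i) (fun a => AX a).
Proof.
split=> [i|a].
  by apply: coord_mx_comp => // x; rewrite /= scalerA vertex_elemK.
split; apply: coord_mx_comp => // x; rewrite /= scalerA.
  by rewrite arrow_elem_tail.
by rewrite head_arrow_elem.
Qed.

Local Notation diff := (rep_diff (@Defs.head Q) (@Defs.tail Q)
  (fun i => EX i) (fun a => AX a) (fun i => EY i) (fun a => AY a)).
Local Notation arrow_part := (arrow_corner (@Defs.head Q) (@Defs.tail Q)
  (fun i => EX i) (fun i => EY i)).

Definition mx_arrow (z : {ffun arrow Q -> 'M[R]_(n, m)}) (a : arrow Q) :
  {linear restrict X -> restrict Y} := to_linear (mx_linear pX qY (z a)).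

Lemma pY_corner z a x :
  pY (corner (mx_arrow z) a x) = pX x *m (arrow_part z) a.
Proof. by rewrite ffunE !mulmxA !mul_coord_mx pXK. Qed.

(** Uses of each [G i] only the block from [e_i X] to [e_i Y], which forces compatibility with the
    vertices. *)
Definition block_map (G : {ffun vertex Q -> 'M[R]_(n, m)}) (x : restrict X) :
    restrict Y :=
  \sum_i e_ i *: (qY (pX (e_ i *: (x : X)) *m G i) : Y).

Lemma block_map_linear G : linear (block_map G).
Proof.
move=> r x y; rewrite /block_map scaler_sumr -big_split; apply: eq_bigr => i _.
have := linearP (act Y (e_ i) \o to_linear (mx_linear pX qY (G i)) \o act X (e_ i)) r x y.
exact.
Qed.

Lemma vertex_block_map G i (x : X) :
  e_ i *: (block_map G x : Y) = e_ i *: (qY (pX (e_ i *: x) *m G i) : Y).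
Proof.
rewrite /block_map scaler_sumr (bigD1 i) //= scalerA vertex_elemK big1 ?addr0 // => j ji.
by rewrite scalerA vertex_elem_orth 1?eq_sym // [LHS]scale0r.
Qed.

Lemma block_map_vertex G i (x : X) :
  block_map G (e_ i *: x) = e_ i *: (block_map G x : Y).
Proof.
rewrite vertex_block_map /block_map (bigD1 i) //= scalerA vertex_elemK.
rewrite big1 ?addr0 // => j ji; rewrite scalerA vertex_elem_orth // [X in pX X]scale0r.
by rewrite (linear0 pX) mul0mx (linear0 qY) scaler0.
Qed.

(** This is the dictionary between matrices and modules: kernel elements of [diff] give
    homomorphisms, and values of [diff] give the coboundaries of [ext_arrow0]. *)
Lemma block_map_arrow G a (x : X) :
  pY (block_map G (a_ a *: x) - a_ a *: (block_map G x : Y) : Y) = pX x *m (diff G) a.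
Proof.
have -> : block_map G (a_ a *: x) =
    e_ (Defs.head a) *: (qY (pX (a_ a *: x) *m G (Defs.head a)) : Y).
  rewrite -{1}(head_arrow_elem R a) -scalerA block_map_vertex vertex_block_map.
  by rewrite scalerA head_arrow_elem.
have -> : a_ a *: (block_map G x : Y) =
    a_ a *: (qY (pX (e_ (Defs.tail a) *: x) *m G (Defs.tail a)) : Y).
  rewrite -{1}(arrow_elem_tail R a) -scalerA vertex_block_map.
  by rewrite scalerA arrow_elem_tail.
rewrite ffunE mulmxBr !mulmxA !mul_coord_mx pXK.
exact: linearB.
Qed.

(** For [X = Y] this turns the vanishing of Ext^1 into [rigid_rep]. *)
Lemma ext_arrow0_diff z u : ext_arrow (mx_arrow z) u ->
  u = 0 <-> exists G, diff G = arrow_part z.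
Proof.
move=> zu; rewrite (ext_arrow0 zu); split.
  (* One matrix of [g] serves at every vertex, because [diff] extracts the vertex blocks. *)
  move=> [g ge ga]; exists [ffun _ => coord_mx qX pY g].
  apply/ffunP => a; apply/row_matrixP => i; rewrite !rowE.
  rewrite !ffunE mulmxBr !mulmxA !mul_coord_mx !pXK !pYK.
  rewrite -[RHS]/(pY (corner (mx_arrow z) a (qX _))) ga linearB /=.
  congr (pY _ - pY _).
    by rewrite -ge scalerA head_arrow_elem.
  by rewrite ge scalerA arrow_elem_tail.
move=> [G GE]; exists (to_linear (block_map_linear G)) => [i x|a x].
  exact: block_map_vertex.
apply: (can_inj pYK).
by rewrite pY_corner -GE -block_map_arrow.
Qed.
End Coordinates.

Lemma rigid_coord_rep (R : comNzRingType) (Q : quiver) (X : lmodType (path_algebra R Q))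
    n (p : {linear restrict X -> 'rV[R]_n}) (q : {linear 'rV[R]_n -> restrict X}) :
  cancel p q -> rigid X ->
  rigid_rep (@Defs.head Q) (@Defs.tail Q)
    (fun i => coord_mx q p (act X (vertex_elem R i)))
    (fun a => coord_mx q p (act X (arrow_elem R a))).
Proof.
move=> pK rigX z; have [u uP] := ext_arrow_exists (mx_arrow p q z).
exact: (ext_arrow0_diff pK pK uP).1 (rigX u).
Qed.

(** * Hom and Ext^1 as retracts of free modules *)

Section RegularDifferential.
Variables (R : comNzRingType) (Q : quiver) (X Y : lmodType (path_algebra R Q)).
Variables (n m : nat).
Local Notation e_ i := (vertex_elem R i).
Local Notation a_ a := (arrow_elem R a).
Variables (pX : {linear restrict X -> 'rV[R]_n}) (qX : {linear 'rV[R]_n -> restrict X}).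
Variables (pY : {linear restrict Y -> 'rV[R]_m}) (qY : {linear 'rV[R]_m -> restrict Y}).
Hypotheses (pXK : cancel pX qX) (pYK : cancel pY qY).
Local Notation EX i := (coord_mx qX pX (act X (e_ i))).
Local Notation AX a := (coord_mx qX pX (act X (a_ a))).
Local Notation EY i := (coord_mx qY pY (act Y (e_ i))).
Local Notation AY a := (coord_mx qY pY (act Y (a_ a))).
Local Notation diff := (rep_diff (@Defs.head Q) (@Defs.tail Q)
  (fun i => EX i) (fun a => AX a) (fun i => EY i) (fun a => AY a)).
Local Notation arrow_part := (arrow_corner (@Defs.head Q) (@Defs.tail Q)
  (fun i => EX i) (fun i => EY i)).

Variable psi : {linear {ffun arrow Q -> 'M[R]_(n, m)} -> {ffun vertex Q -> 'M[R]_(n, m)}}.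
Hypothesis psiP : forall G, diff (psi (diff G)) = diff G.

Lemma block_map_is_linear x : linear (fun G => block_map pX qY G x).
Proof.
move=> r G H; rewrite /block_map scaler_sumr -big_split; apply: eq_bigr => i _.
rewrite !ffunE mulmxDr -scalemxAr.
exact: (linearP (act Y (e_ i) \o qY)).
Qed.

Lemma block_map_hom G : diff G = 0 -> linear (block_map pX qY G : X -> Y).
Proof.
move=> G0; apply: path_algebra_linear => [|i x|a x].
- exact: block_map_linear.
- exact: block_map_vertex.
apply/eqP; rewrite -subr_eq0; apply/eqP/(can_inj pYK).
by rewrite (block_map_arrow pY qY pXK) G0 ffunE mulmx0 (linear0 pY).
Qed.

(** By regularity [k = 1 - psi d] projects onto the kernel of [d], so [block_map] after [k] always
    yields a homomorphism. The matrix of a homomorphism is fixed by [k], so this retracts a free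
    module onto Hom. *)
Lemma fg_projective_hom : fg_projective (module_hom X Y).
Proof.
pose i (f : module_hom X Y) : {ffun vertex Q -> 'M[R]_(n, m)} :=
  [ffun _ => coord_mx qX pY (to_linear (restrict_linear f))].
have li : linear i.
  by move=> r f g; apply/ffunP => j; rewrite !ffunE; exact: coord_mx_is_linear.
have di f : diff (i f) = 0.
  apply/ffunP => a; apply/row_matrixP => j; rewrite !rowE.
  rewrite !ffunE mulmxBr !mulmxA !mul_coord_mx !pXK !pYK /=.
  by rewrite !linearZ_LR /= !scalerA head_arrow_elem arrow_elem_tail subrr mulmx0.
pose k : {linear {ffun vertex Q -> 'M[R]_(n, m)} -> {ffun vertex Q -> 'M[R]_(n, m)}} :=
  idfun \- (psi \o diff).
have dk G : diff (k G) = 0 by rewrite /k linearB /= psiP subrr.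
have rP G : (block_map pX qY (k G) : X -> restrict Y) \in @hom_pred _ _ X Y.
  by apply/asboolP/block_map_hom.
have lr : linear (fun G => ModuleHom (rP G)).
  move=> r G H; apply: homP => x; rewrite hom_applyD hom_applyZ.
  rewrite -[LHS]/(block_map pX qY (k (r *: G + H)) x) linearP.
  exact: block_map_is_linear.
apply: (fg_projective_retract (i := to_linear li) (r := to_linear lr)) => f.
apply: homP => x; rewrite -[LHS]/(block_map pX qY (k (i f)) x).
rewrite /k /= di linear0 subr0 -[RHS]scale1r -(sum_vertex_elem R Q) scaler_suml.
apply: eq_bigr => j _; rewrite ffunE coord_mxK //= linearZ_LR /= scalerA.
by rewrite vertex_elemK.
Qed.

(** [C] maps a free module onto Ext^1. The map [k], which is [1 - d psi] on the corner summand,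
    kills the kernel of [C] and satisfies [C k = C]; hence it factors through [C] and provides a
    linear section. *)
Lemma fg_projective_ext : projective (restrict X) -> fg_projective (Ext1 X Y).
Proof.
move=> X_proj.
have [c cP] := choice (fun z => ext_arrow_exists (mx_arrow pX qY z)).
have lc : linear c.
  move=> r z w; apply: ext_arrow_inj (cP _) _; apply: ext_arrowD (cP z) (cP w) _ => a x.
  apply: (can_inj pYK); rewrite (linearP pY) !(pY_corner pY qY pXK).
  by rewrite linearP !ffunE mulmxDr -scalemxAr.
pose C : {linear _ -> _} := to_linear lc.
have c0 z : C z = 0 <-> exists G, diff G = arrow_part z.
  exact: ext_arrow0_diff.
have cornerK z : arrow_part (arrow_part z) = arrow_part z.
  exact: arrow_cornerK (coord_matrix_rep pXK) (coord_matrix_rep pYK).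
have c_surj u : exists z, C z = u.
  have [eta etaP] := ext_arrow_surj X_proj u.
  exists [ffun a => coord_mx qX pY (eta a)].
  apply: ext_arrow_inj (cP _) _; apply: ext_arrow_corner etaP => a x.
  by rewrite /= ffunE coord_mxK.
have [z zP] := choice c_surj.
pose k : {linear {ffun arrow Q -> 'M[R]_(n, m)} -> {ffun arrow Q -> 'M[R]_(n, m)}} :=
  (idfun \- (diff \o psi)) \o arrow_part.
have k0 w : C w = 0 -> k w = 0.
  by move=> /c0[G GE]; rewrite /k /= -GE psiP subrr.
have ck w : C (k w) = C w.
  apply/eqP; rewrite -subr_eq0 -linearB; apply/eqP/c0.
  exists (- psi (arrow_part w)).
  rewrite /k linearN linearB linearB /= cornerK arrow_corner_diff.
  - by rewrite addrAC subrr add0r.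
  - exact: coord_matrix_rep pXK.
  - exact: coord_matrix_rep pYK.
(* The preimages [z] are chosen without linearity; their deviation from it lies in the kernel of
   [C], which [k] kills. *)
have li : linear (fun u => k (z u)).
  move=> r u v; apply/eqP; rewrite -linearP -subr_eq0 -linearB; apply/eqP/k0.
  by rewrite linearB linearP !zP subrr.
apply: (fg_projective_retract (i := to_linear li) (r := C)) => u.
exact: etrans (ck _) (zP u).
Qed.
End RegularDifferential.

Theorem theoremA (R : comNzRingType) (Q : quiver)
    (X Y : lmodType (path_algebra R Q)) :
  lattice X -> lattice Y -> rigid X -> rigid Y ->
  fg_projective (module_hom X Y) /\ fg_projective (Ext1 X Y).
Proof.
move=> latX latY rigX rigY.
have [n [pX [qX pXK]]] := fg_projective_coordinates latX.
have [m [pY [qY pYK]]] := fg_projective_coordinates latY.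
have [psi psiP] := rep_diff_regular (coord_matrix_rep pXK) (coord_matrix_rep pYK)
  (rigid_coord_rep pXK rigX) (rigid_coord_rep pYK rigY).
split; first exact: (fg_projective_hom pXK pYK psiP).
exact: (fg_projective_ext pXK pYK psiP latX.2).
Qed.
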